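(* Let $a,b>0$, let $g\in L^2(\mathbb R)$, and let $g_n(x)=g(x-na)$ for $n\in\mathbb Z$. Then $\{E_{mb}T_{na}g\}_{m,n\in\mathbb Z}$ is a Gabor frame for $L^2(\mathbb R)$ if and only if $\{g_n\}_{n\in\mathbb Z}$ is a non-standard modular frame for $L^{\infty}_{1/b}(\ell_2)$.
   Context: For $a,b\in\mathbb R$, $T_af(x)=f(x-a)$ and $E_bf(x)=e^{2\pi i b x}f(x)$. The family $\{E_{mb}T_{na}g\}_{m,n\in\mathbb Z}$ is a Gabor frame for $L^2(\mathbb R)$ if there are constants $A,B>0$ with $A\|f\|^2\le\sum_{m,n}|\langle f,E_{mb}T_{na}g\rangle|^2\le B\|f\|^2$ for all $f\in L^2(\mathbb R)$. For $b>0$, $L^{\infty}_{1/b}(\ell_2)$ is the set of measurable functions $f:\mathbb R\to\mathbb C$ (identified when equal a.e.) with $\|f\|^2_{L^{\infty}_{1/b}(\ell_2)}=\operatorname*{ess\,sup}_{x\in[0,1/b]}\sum_{k\in\mathbb Z}|f(x-\frac kb)|^2<\infty$. It is a Hilbert $C^*$-module over the $C^*$-algebra $L^\infty[0,1/b)$ (identified with the bounded $\frac1b$-periodic functions on $\mathbb R$) with the $C^*$-valued inner product $$\langle f,g\rangle_{1/b}(x)=\sum_{k\in\mathbb Z}f\left(x-\tfrac kb\right)\overline{g\left(x-\tfrac kb\right)},$$ where the series is only required to converge weak-* in $L^\infty[0,1/b]$. Let $\mathcal M$ be a Hilbert $C^*$-module over a unital $C^*$-algebra $\mathcal A$ with inner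 product $\langle\cdot,\cdot\rangle_{\mathcal A}$. A sequence $\{x_n\}\subset\mathcal M$ is a modular frame for $\mathcal M$ if there are real constants $C,D>0$ such that $$C\langle x,x\rangle_{\mathcal A}\le\sum_n\langle x,x_n\rangle_{\mathcal A}\langle x_n,x\rangle_{\mathcal A}\le D\langle x,x\rangle_{\mathcal A}\quad\text{for all }x\in\mathcal M.$$ It is called standard if the middle sum always converges in norm; in the non-standard setting the middle sum is only required to converge weakly (here: weak-* in $L^\infty[0,1/b]$), so that for $\mathcal M=L^{\infty}_{1/b}(\ell_2)$ the condition reads: $g_n\in L^{\infty}_{1/b}(\ell_2)$ and $C\langle f,f\rangle_{1/b}(x)\le\sum_n|\langle f,g_n\rangle_{1/b}(x)|^2\le D\langle f,f\rangle_{1/b}(x)$ for a.e. $x$, for all $f\in L^{\infty}_{1/b}(\ell_2)$. *)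

(* Defs.v *)
From HB Require Import structures.
From mathcomp Require Import all_boot all_order all_algebra.
From mathcomp Require Import finmap.
From mathcomp Require Import complex.
From mathcomp Require Import all_classical all_reals all_analysis.
From mathcomp Require Import ess_sup_inf.
From mathcomp Require summability.

Set Implicit Arguments.
Unset Strict Implicit.
Unset Printing Implicit Defensive.

Import Order.TTheory GRing.Theory Num.Theory.
Import numFieldNormedType.Exports.

Local Open Scope classical_set_scope.
Local Open Scope ring_scope.

(* Elements of the function spaces below are represented by honest functions
   R -> R[i]; every notion defined here is invariant under a.e. equality. *)

Section ComplexFunctions.
Variable R : realType.
Implicit Types (D : set R) (f h : R -> R[i]).

Local Notation mu := (@lebesgue_measure R).

(* `|z| itself lives in R[i]; this is the same modulus with values in R. *)
Definition cabs (z : R[i]) : R := complex.Re `|z|.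

Definition expi (t : R) : R[i] := (cos t +i* sin t)%C.

Definition cmeasurable D f : Prop :=
  measurable_fun D (@complex.Re R \o f) /\ measurable_fun D (@complex.Im R \o f).

Definition cintegrable D f : Prop :=
  mu.-integrable D (EFin \o (@complex.Re R \o f)) /\
  mu.-integrable D (EFin \o (@complex.Im R \o f)).

Definition cintegral D f : R[i] :=
  (Rintegral mu D (@complex.Re R \o f) +i* Rintegral mu D (@complex.Im R \o f))%C.

Definition L2normsq f : \bar R := (\int[mu]_x ((cabs (f x)) ^+ 2)%:E)%E.

Definition L2 : set (R -> R[i]) :=
  [set f | cmeasurable setT f /\ (L2normsq f < +oo)%E].

Definition L2ip f h : R[i] := cintegral setT (fun x => f x * (h x)^*%C).

End ComplexFunctions.

Section Gabor.
Variable R : realType.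
Implicit Types (a b : R) (f g : R -> R[i]).

Definition translation a f : R -> R[i] := fun x => f (x - a).

Definition modulation b f : R -> R[i] := fun x => expi (2 * pi * b * x) * f x.

Definition gabor_system a b g (mn : int * int) : R -> R[i] :=
  modulation (mn.1%:~R * b) (translation (mn.2%:~R * a) g).

Definition gabor_frame a b g : Prop :=
  exists A B : R, [/\ 0 < A, 0 < B & forall f, L2 f ->
    let S := (\esum_(mn in [set: int * int])
                ((cabs (L2ip f (gabor_system a b g mn))) ^+ 2)%:E)%E in
    (A%:E * L2normsq f <= S)%E /\ (S <= B%:E * L2normsq f)%E].

End Gabor.

Section Module.
Variables (R : realType) (b : R).
Implicit Types (f g h : R -> R[i]) (u : int -> R -> R[i]).

Local Notation mu := (@lebesgue_measure R).
Local Notation I := `[0, b^-1]%classic.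

Definition esssup_period (F : R -> \bar R) : \bar R :=
  ess_sup (mrestr mu (measurable_itv `[0, b^-1])) F.

(* L^oo[0, 1/b]: only the values on [0, 1/b] matter, so there is no need to
   extend periodically. *)
Definition Linf : set (R -> R[i]) :=
  [set h | cmeasurable I h /\ (esssup_period (fun x => (cabs (h x))%:E) < +oo)%E].

Definition L1 : set (R -> R[i]) := [set phi | cintegrable I phi].

(* [wstar_sum u h]: the series of the [u k], [k : int], converges
   (unconditionally, i.e. along the finite sets of indices) to [h] in the
   weak-* topology of L^oo[0, 1/b] = (L^1[0, 1/b])^*. *)
Definition wstar_sum u h : Prop :=
  [/\ forall k, Linf (u k), Linf h &
      forall phi, L1 phi ->
        (fun F : {fset int} =>
           cabs (cintegral I (fun x => (\sum_(k <- F) u k x) * phi x)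
                 - cintegral I (fun x => h x * phi x)))
          @ summability.totally --> (0 : R)].

Definition mod_normsq f : \bar R :=
  esssup_period (fun x =>
    (\esum_(k in [set: int]) ((cabs (f (x - k%:~R / b))) ^+ 2)%:E)%E).

Definition Linfl2 : set (R -> R[i]) :=
  [set f | cmeasurable setT f /\ (mod_normsq f < +oo)%E].

(* A weak-* limit is unique up to a.e. equality; [xget] picks one. *)
Definition mod_ip f g : R -> R[i] :=
  xget (cst 0)
    [set h | wstar_sum
       (fun k x => f (x - k%:~R / b) * (g (x - k%:~R / b))^*%C) h].

Definition nonstandard_modular_frame (g_ : int -> R -> R[i]) : Prop :=
  (forall n, Linfl2 (g_ n)) /\
  exists C D : R, [/\ 0 < C, 0 < D & forall f, Linfl2 f ->
    exists S : R -> R[i],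
      wstar_sum (fun n x => mod_ip f (g_ n) x * mod_ip (g_ n) f x) S /\
      {ae mu, forall x, I x ->
         C%:C%C * mod_ip f f x <= S x /\ S x <= D%:C%C * mod_ip f f x}].

End Module.

(* Main.v *)
(* For fixed n, the coefficients <f, E_{mb} T_{na} g> are the Fourier coefficients
   over a period of length 1/b of the bracket <f, g_n>_{1/b}, so by Parseval's
   identity the Gabor frame sum of f equals (1/b) times the integral over [0, 1/b]
   of sum_n |<f, g_n>_{1/b}|^2, while ||f||^2 is the integral of <f, f>_{1/b}.
   Integrating the pointwise modular inequality gives the Gabor frame inequality
   for f in L^oo_{1/b}(l_2), and truncating f to the periodic sets
   {<f, f>_{1/b} < j} extends it to L^2.  Conversely, applying the Gabor frame
   inequality to f restricted to 1/b-periodic sets localizes it to an a.e.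
   inequality; that g_n lies in L^oo_{1/b}(l_2) follows by testing with
   restrictions of g_n itself.

   Parseval's identity is proved for the real basis cos + sin: the functions
   satisfying it form a closed subspace, which contains the sawtooth functions by
   an explicit computation resting on sum 1/n^2 = pi^2/6, hence indicators of
   intervals, hence everything by a Dynkin argument. *)

From HB Require Import structures.
From mathcomp Require Import all_boot all_order all_algebra.
From mathcomp Require Import finmap.
From mathcomp Require Import complex.
From mathcomp Require Import all_classical all_reals all_analysis.
From mathcomp Require Import measurable_realfun ess_sup_inf.
From mathcomp Require summability.
From mathcomp Require Import ring lra.
Require Import Defs.

Set Implicit Arguments.
Unset Strict Implicit.
Unset Printing Implicit Defensive.

Import Order.TTheory GRing.Theory Num.Theory.
Import numFieldNormedType.Exports.

Local Open Scope classical_set_scope.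
Local Open Scope ring_scope.

(** * The Basel problem *)

(** The bracket of two [L2] functions is in general only integrable over a period, while Parseval's
    identity needs it square integrable. This holds once one argument lies in [Linfl2]
    ([bracket_sqr_lty]). To show that [g_ n] itself lies in [Linfl2], the bounded argument must
    therefore be the test function: [g_ n] restricted to a periodic set on which its [sqsum] is
    bounded.

    Weak-* convergence is handled by two bridges. [wstar_sum_csum] shows that a family with
    uniformly bounded absolute sums converges weak-* to its pointwise sum; it identifies [mod_ip]
    with the explicit [bracket] and provides the limit in the modular inequality.
    [wstar_sum_integral] tests an arbitrary weak-* limit against the constant 1, which recovers the
    integral of the sum without knowing the limit pointwise.

    Parseval over a period of length 1/b contributes a factor 1/b, so Gabor bounds A, B correspond
    to modular bounds bA, bB. *)

Section Basel.
Variable R : realType.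
Implicit Types (x y : R) (n k m : nat).

Lemma sin_le_id x : 0 <= x -> sin x <= x.
Proof.
move=> x0; pose f := fun t : R => t - sin t.
have df (t : R) : is_derive t (1 : R) f (1 - cos t) by apply: is_derive_eq.
have: f 0 <= f x.
  apply: (@ger0_derive1_ndecr R f 0 x) => //.
  - by move=> t _; rewrite derive1E derive_val subr_ge0 cos_le1.
  - apply: continuous_subspaceT => t.
    by apply: differentiable_continuous; apply/derivable1_diffP.
by rewrite /f sin0 subr0 subr_ge0.
Qed.

(** This is [x <= tan x] cleared of its denominator; the derivative of [sin t - t * cos t] is
    [t * sin t], nonnegative up to [pi]. *)
Lemma mul_cos_le_sin x : 0 <= x <= pi -> x * cos x <= sin x.
Proof.
move=> /andP[x0 xpi].
pose f := fun t : R => sin t - t * cos t.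
have df (t : R) : is_derive t (1 : R) f (t * sin t).
  by apply: is_derive_eq; rewrite /GRing.scale /=; ring.
have: f 0 <= f x.
  apply: (@ger0_derive1_ndecr R f 0 x) => //.
  - move=> t; rewrite in_itv/= => /andP[t0 tx].
    rewrite derive1E derive_val mulr_ge0 ?(ltW t0)//.
    by rewrite sin_ge0_pi// (ltW t0) (le_trans (ltW tx)).
  - apply: continuous_subspaceT => t.
    by apply: differentiable_continuous; apply/derivable1_diffP.
by rewrite /f sin0 mul0r subr0 subr_ge0.
Qed.

(** The upper bound is csc^2 = cot^2 + 1 with cot x <= 1/x. The gap 1 does not depend on [x], so it
    becomes negligible once the sum is rescaled. *)
Lemma csc2_bounds x : 0 < x -> x < pi / 2 ->
  x ^- 2 <= (sin x) ^- 2 <= x ^- 2 + 1.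
Proof.
move=> x0 xp.
have s0 : 0 < sin x by apply: sin_gt0_pihalf; rewrite x0.
have c0 : 0 < cos x by apply: cos_gt0_pihalf; rewrite xp andbT (lt_trans _ x0)// oppr_lt0 divr_gt0 ?pi_gt0.
have sx : sin x <= x := sin_le_id (ltW x0).
have xs : x * cos x <= sin x.
  apply: mul_cos_le_sin; rewrite (ltW x0)/= (le_trans (ltW xp))//.
  by rewrite ler_pdivrMr// ler_peMr ?pi_ge0// ler1n.
have e : cos x ^+ 2 = 1 - sin x ^+ 2 by exact: cos2sin2.
apply/andP; split.
  rewrite lef_pV2 ?posrE ?exprn_gt0//.
  by rewrite ler_pXn2r ?nnegrE ?(ltW s0) ?(ltW x0).
have -> : (sin x) ^- 2 = cos x ^+ 2 / sin x ^+ 2 + 1.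
  by rewrite e; field; rewrite gt_eqF.
rewrite lerD2r ler_pdivrMr ?exprn_gt0// ler_pdivlMl ?exprn_gt0//.
by rewrite -exprMn ler_pXn2r ?nnegrE ?mulr_ge0// ltW.
Qed.

(* Iterating this doubling formula evaluates [\sum_m csc^2(m pi / 2^(k+1))] in closed
   form; [csc2_bounds] then squeezes [\sum_m m^-2]. *)
Lemma csc2_double x : sin x != 0 -> cos x != 0 ->
  (sin x) ^- 2 + (sin (pi / 2 - x)) ^- 2 = 4 * (sin (x *+ 2)) ^- 2.
Proof.
move=> s0 c0.
have -> : sin (pi / 2 - x) = cos x.
  by rewrite addrC sinDpihalf cosN.
rewrite sin_mulr2n.
have e := cos2Dsin2 x.
transitivity ((cos x ^+ 2 + sin x ^+ 2) / (cos x ^+ 2 * sin x ^+ 2)).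
  by field; rewrite s0 c0.
by rewrite e; field; rewrite s0 c0.
Qed.

Let csc2 (M m : nat) : R := (sin (m%:R * pi / (2 * M%:R))) ^- 2.

Let angle_bounds (M m : nat) : (0 < m < M)%N ->
  (0 < m%:R * pi / (2 * M%:R) :> R) /\ (m%:R * pi / (2 * M%:R) < pi / 2 :> R).
Proof.
move=> /andP[m0 mM]; have M0 := ltn_trans m0 mM.
split; first by rewrite divr_gt0 ?mulr_gt0 ?pi_gt0 ?ltr0n.
rewrite invfM mulrA ltr_pdivrMr ?ltr0n// mulrC mulrA mulrC mulrA [ltRHS]mulrC.
by rewrite [ltRHS]mulrC ltr_pM2l ?ltr_nat ?divr_gt0 ?pi_gt0.
Qed.

(** The angles of [m] and [2 * M - m] are complementary, so [csc2_double] merges each such pair into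
    one term for [M]; the unpaired [m = M] has angle pi/4 and contributes 2. *)
Let sum_csc2_fold (M : nat) : (0 < M)%N ->
  \sum_(1 <= m < 2 * M) csc2 (2 * M) m = 2 + 4 * \sum_(1 <= m < M) csc2 M m.
Proof.
move=> M0.
have M0' : M%:R != 0 :> R by rewrite pnatr_eq0 -lt0n.
rewrite (big_cat_nat (n := M)) //=; last by rewrite mul2n -addnn leq_addr.
rewrite [X in _ + X = _]big_ltn; last by rewrite mul2n -addnn -[ltnLHS]addn0 ltn_add2l.
rewrite [csc2 _ M](_ : _ = 2); last first.
  rewrite /csc2 natrM (_ : M%:R * pi / (2 * (2 * M%:R)) = pi / 4 :> R); last by field.
  have e : sin (pi / 4 : R) = cos (pi / 4).
    by rewrite -cosBpihalf -cosN; congr cos; field.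
  have e1 := cos2Dsin2 (pi / 4 : R); rewrite -e in e1.
  have -> : sin (pi / 4 : R) ^+ 2 = 2^-1 by lra.
  by rewrite invrK.
rewrite addrCA; congr +%R.
rewrite -[M.+1]add1n big_addn mul2n -addnn addnK.
rewrite [X in _ + X]big_nat_rev/= -big_split mulr_sumr/=.
apply: eq_big_nat => m mM.
have [a0 api] := angle_bounds mM.
have eMM : (M + M)%:R = 2 * M%:R :> R by rewrite natrD; ring.
have -> : csc2 M m = sin ((m%:R * pi / (2 * (M + M)%:R) : R) *+ 2) ^- 2.
  by congr (sin _ ^- 2); rewrite eMM mulr2n; field.
have a2 : (m%:R * pi / (2 * (M + M)%:R) : R) = (m%:R * pi / (2 * M%:R)) / 2.
  by rewrite eMM; field.
rewrite -csc2_double; last 2 first.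
- by rewrite gt_eqF// sin_gt0_pihalf// a2 divr_gt0//= ltr_pdivrMr// (lt_le_trans api)// ler_peMr ?ler1n// divr_ge0// pi_ge0.
- rewrite gt_eqF// cos_gt0_pihalf// a2 (lt_trans _ (divr_gt0 a0 _))//=; last by rewrite oppr_lt0 divr_gt0// pi_gt0.
  by rewrite ltr_pdivrMr// (lt_le_trans api)// ler_peMr ?ler1n// divr_ge0// pi_ge0.
congr (_ + sin _ ^- 2).
have /andP[_ mM'] := mM.
by rewrite add1n subSS natrD natrB ?(ltnW mM')// eMM; field.
Qed.

(** The recursion s -> 2 + 4s starts from the empty sum 0 and has fixed point -2/3. *)
Let sum_csc2_pow2 k : \sum_(1 <= m < 2 ^ k) csc2 (2 ^ k) m = 2 / 3 * (4 ^+ k - 1).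
Proof.
elim: k => [|k ih]; first by rewrite expn0 big_geq// expr0 subrr mulr0.
by rewrite expnS sum_csc2_fold ?expn_gt0// ih exprS; field.
Qed.

Let sum_inv2_pow2 k :
  (pi ^+ 2 / 6 : R) * (1 - 4 ^- k) - pi ^+ 2 / 4 * 2 ^- k <=
  \sum_(1 <= m < 2 ^ k) (m%:R ^- 2 : R) <= pi ^+ 2 / 6 * (1 - 4 ^- k).
Proof.
have p0 : 0 < (pi : R) := pi_gt0 R.
have p1 : (pi : R) != 0 by rewrite gt_eqF.
have e4 : (4 ^+ k : R) = (2 ^ k)%N%:R ^+ 2 by rewrite natrX -exprM mulnC exprM; congr (_ ^+ _); ring.
have k0 : (2 ^ k)%N%:R != 0 :> R by rewrite pnatr_eq0 -lt0n expn_gt0.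
have k1 : 0 < (2 ^ k)%N%:R :> R by rewrite ltr0n expn_gt0.
(* [c] is the squared mesh (pi / 2^(k+1))^2, so [m ^- 2] is [c] times the inverse square of the m-th
   angle. *)
pose c : R := (pi ^+ 2 / 4) * 4 ^- k.
have c0 : 0 < c by rewrite mulr_gt0 ?invr_gt0 ?exprn_gt0// divr_gt0// exprn_gt0.
have E : \sum_(1 <= m < 2 ^ k) (m%:R ^- 2 : R) =
    c * \sum_(1 <= m < 2 ^ k) (m%:R * pi / (2 * (2 ^ k)%:R)) ^- 2.
  rewrite mulr_sumr; apply: eq_big_nat => m /andP[m0 _].
  have m0' : m%:R != 0 :> R by rewrite pnatr_eq0 -lt0n.
  by rewrite /c e4; move: ((2 ^ k)%N%:R : R) (pi : R) k0 p1 => N p N0 p0'; field; rewrite N0 p0' m0'.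
have E2 : pi ^+ 2 / 6 * (1 - 4 ^- k) = c * (2 / 3 * (4 ^+ k - 1)).
  by rewrite /c; field; rewrite expf_neq0.
rewrite E E2 -sum_csc2_pow2; apply/andP; split; last first.
  rewrite ler_pM2l//; apply: ler_sum_nat => m mM.
  by have [a0 a1] := angle_bounds mM; have /andP[] := csc2_bounds a0 a1.
have -> : pi ^+ 2 / 4 * 2 ^- k = c * (2 ^ k)%N%:R.
  by rewrite /c e4 -natrX; move: ((2 ^ k)%N%:R : R) k0 => N N0; field.
rewrite -mulrBr ler_pM2l// lerBlDr.
(* Each of the fewer than 2^k terms loses at most 1 in [csc2_bounds]. *)
apply: (@le_trans _ _ (\sum_(1 <= m < 2 ^ k) ((m%:R * pi / (2 * (2 ^ k)%:R)) ^- 2 + 1))).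
  apply: ler_sum_nat => m mM.
  by have [a0 a1] := angle_bounds mM; have /andP[] := csc2_bounds a0 a1.
rewrite big_split/= lerD2l sumr_const_nat ler_nat leq_subr//.
Qed.

Lemma basel : (\sum_(0 <= n <oo) ((n.+1)%:R ^- 2)%:E = (pi ^+ 2 / 6)%:E :> \bar R)%E.
Proof.
have p0 : 0 < (pi : R) := pi_gt0 R.
have e n : (\sum_(0 <= i < n) ((i.+1)%:R ^- 2)%:E)%E = (\sum_(1 <= i < n.+1) (i%:R ^- 2 : R))%:E.
  by rewrite sumEFin big_add1.
apply/eqP; rewrite eq_le; apply/andP; split.
  apply: lime_le; first by apply: is_cvg_nneseries => n _ _; rewrite lee_fin invr_ge0 exprn_ge0.
  apply: nearW => n; rewrite e lee_fin.
  have /andP[_ H] := sum_inv2_pow2 n.+1.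
  apply: le_trans (le_trans H _); last first.
    by rewrite ler_piMr ?divr_ge0 ?exprn_ge0 ?(ltW p0)// lerBlDr lerDl invr_ge0 exprn_ge0.
  rewrite [leRHS](big_cat_nat (n := n.+1))//=; last exact: ltnW (ltn_expl _ _).
  by rewrite lerDl sumr_ge0// => i _; rewrite invr_ge0 exprn_ge0.
apply/lee_addgt0Pr => eps eps0.
(* The two errors of [sum_inv2_pow2] add up to at most 5/12 pi^2 2^-k. *)
have [k hk] : exists k, pi ^+ 2 * 2 ^- k <= eps.
  exists (Num.bound (pi ^+ 2 / eps)).
  rewrite ler_pdivrMr ?exprn_gt0// mulrC -ler_pdivrMr//.
  apply: (le_trans (ltW (archi_boundP _))); first by rewrite divr_ge0 ?exprn_ge0 ?ltW.
  by rewrite -natrX ler_nat ltnW// ltn_expl.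
have /andP[H _] := sum_inv2_pow2 k.
apply: (@le_trans _ _ ((\sum_(1 <= i < (2 ^ k).-1.+1) (i%:R ^- 2 : R) + eps)%:E)); last first.
  rewrite EFinD leeD2r// -e; apply: nneseries_lim_ge => n _ _.
  by rewrite lee_fin invr_ge0 exprn_ge0.
rewrite prednK ?expn_gt0// lee_fin -lerBlDr; apply: le_trans H.
suff : pi ^+ 2 / 6 * 4 ^- k + pi ^+ 2 / 4 / 2 ^+ k <= eps by lra.
apply: le_trans hk.
have : (4 : R) ^- k <= 2 ^- k by rewrite lef_pV2 ?posrE ?exprn_gt0// lerXn2r ?nnegrE// ler_nat.
have : 0 <= (pi : R) ^+ 2 by rewrite exprn_ge0// ltW.
have : 0 <= (2 : R) ^- k by rewrite invr_ge0 exprn_ge0.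
move: (pi ^+ 2 : R) (2 ^- k : R) (4 ^- k : R) => x y z; nra.
Qed.

End Basel.

(** * Parseval's identity for the Hartley system *)

Section RealIntegrable.
Context d (X : measurableType d) (R : realType).
Variables (mu : {measure set X -> \bar R}) (D : set X).
Hypothesis mD : measurable D.
Implicit Types f h : X -> R.

Lemma integrable_addr f h : mu.-integrable D (EFin \o f) -> mu.-integrable D (EFin \o h) ->
  mu.-integrable D (EFin \o (fun x => f x + h x)).
Proof. by move=> mf mh; apply: eq_integrable (integrableD mD mf mh). Qed.

Lemma integrable_scaler (c : R) f : mu.-integrable D (EFin \o f) ->
  mu.-integrable D (EFin \o (fun x => c * f x)).
Proof. by move=> mf; apply: eq_integrable (integrableZl mD c mf). Qed.

Lemma integrable_subr f h : mu.-integrable D (EFin \o f) -> mu.-integrable D (EFin \o h) ->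
  mu.-integrable D (EFin \o (fun x => f x - h x)).
Proof. by move=> mf mh; apply: eq_integrable (integrableB mD mf mh). Qed.

Lemma integrable_le f h : measurable_fun D f -> (forall x, D x -> `|f x| <= h x) ->
  mu.-integrable D (EFin \o h) -> mu.-integrable D (EFin \o f).
Proof.
move=> mf fh; apply: le_integrable => //; first exact/measurable_EFinP.
by move=> x Dx /=; rewrite lee_fin (le_trans (fh x Dx))// ler_norm.
Qed.

Lemma integrable_sumr (I : Type) (s : seq I) (f : I -> X -> R) :
  (forall i, mu.-integrable D (EFin \o f i)) ->
  mu.-integrable D (EFin \o (fun x => \sum_(i <- s) f i x)).
Proof.
move=> mf; elim: s => [|i s ih].
  by under [X in _ \o X]eq_fun do rewrite big_nil; exact: integrable0.
by under [X in _ \o X]eq_fun do rewrite big_cons; exact: integrable_addr.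
Qed.

Lemma Rintegral_sum (I : Type) (s : seq I) (f : I -> X -> R) :
  (forall i, mu.-integrable D (EFin \o f i)) ->
  \int[mu]_(x in D) (\sum_(i <- s) f i x) = \sum_(i <- s) \int[mu]_(x in D) f i x.
Proof.
move=> mf; elim: s => [|i s ih].
  rewrite big_nil -[RHS](@Rintegral_set0 _ _ _ mu (cst 0)) Rintegral_mkcond [RHS]Rintegral_mkcond.
  by apply: eq_Rintegral => x _; rewrite patch_set0 patchE big_nil; case: ifP.
rewrite big_cons -ih -RintegralD//; last exact: integrable_sumr.
by apply: eq_Rintegral => x _; rewrite big_cons.
Qed.

Lemma EFin_Rintegral f : mu.-integrable D (EFin \o f) ->
  ((\int[mu]_(x in D) f x)%R)%:E = (\int[mu]_(x in D) (f x)%:E)%E.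
Proof. by move=> mf; rewrite /Rintegral fineK//; exact: integrable_fin_num. Qed.

Definition sqint f := measurable_fun D f /\ mu.-integrable D (EFin \o (fun x => f x ^+ 2)).

Lemma sqint_mul f h : sqint f -> sqint h -> mu.-integrable D (EFin \o (fun x => f x * h x)).
Proof.
move=> [mf f2] [mh h2]; apply: integrable_le (integrable_addr f2 h2).
  exact: measurable_funM.
move=> x _; rewrite normrM -[f x ^+ 2]real_normK ?num_real// -[h x ^+ 2]real_normK ?num_real//.
by have := normr_ge0 (f x); have := normr_ge0 (h x); nra.
Qed.

Lemma sqintZ (c : R) f : sqint f -> sqint (fun x => c * f x).
Proof.
move=> [mf f2]; split; first exact: measurable_funM.
by under [X in _ \o X]eq_fun do rewrite exprMn; exact: integrable_scaler.
Qed.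

Lemma sqintD f h : sqint f -> sqint h -> sqint (fun x => f x + h x).
Proof.
move=> sf sh; have [[mf f2] [mh h2]] := (sf, sh).
split; first exact: measurable_funD.
under [X in _ \o X]eq_fun do rewrite sqrrD -mulr_natl.
by do 2 apply: integrable_addr => //; apply: integrable_scaler; exact: sqint_mul.
Qed.

Lemma sqintB f h : sqint f -> sqint h -> sqint (fun x => f x - h x).
Proof.
move=> sf sh; have := sqintD sf (sqintZ (-1) sh).
by under [X in sqint X]eq_fun do rewrite mulN1r.
Qed.

Lemma sqint_sum (I : Type) (s : seq I) (f : I -> X -> R) :
  (forall i, sqint (f i)) -> sqint (fun x => \sum_(i <- s) f i x).
Proof.
move=> mf; elim: s => [|i s ih].
  under [X in sqint X]eq_fun do rewrite big_nil.
  by split => //; under [X in _ \o X]eq_fun do rewrite expr0n; exact: integrable0.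
by under [X in sqint X]eq_fun do rewrite big_cons; exact: sqintD.
Qed.

Lemma sqint_bounded f (M : R) : (mu D < +oo)%E -> measurable_fun D f ->
  (forall x, D x -> `|f x| <= M) -> sqint f.
Proof.
move=> Dfin mf fM; split => //.
apply: measurable_bounded_integrable => //; first exact: measurable_funX.
exists (M ^+ 2); split; first exact: num_real.
move=> A MA x Dx; apply: le_trans (ltW MA) => /=.
by rewrite normrX lerXn2r ?nnegrE ?fM//; apply: le_trans (fM x Dx).
Qed.

Definition ip f h := \int[mu]_(x in D) (f x * h x).

Lemma ipC f h : ip f h = ip h f.
Proof. by apply: eq_Rintegral => x _; rewrite mulrC. Qed.

Lemma ipZl c f h : sqint f -> sqint h -> ip (fun x => c * f x) h = c * ip f h.
Proof.
move=> sf sh; rewrite /ip -RintegralZl//; last exact: sqint_mul.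
by apply: eq_Rintegral => x _; rewrite mulrA.
Qed.

Lemma ipDl f1 f2 h : sqint f1 -> sqint f2 -> sqint h ->
  ip (fun x => f1 x + f2 x) h = ip f1 h + ip f2 h.
Proof.
move=> sf1 sf2 sh; rewrite /ip -RintegralD//; last 2 first.
  exact: sqint_mul. exact: sqint_mul.
by apply: eq_Rintegral => x _; rewrite mulrDl.
Qed.

Lemma ipBl f1 f2 h : sqint f1 -> sqint f2 -> sqint h ->
  ip (fun x => f1 x - f2 x) h = ip f1 h - ip f2 h.
Proof.
move=> sf1 sf2 sh; rewrite /ip -RintegralB//; last 2 first.
  exact: sqint_mul. exact: sqint_mul.
by apply: eq_Rintegral => x _; rewrite mulrBl.
Qed.

Lemma ip_suml (I : Type) (s : seq I) (f : I -> X -> R) h :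
  (forall i, sqint (f i)) -> sqint h ->
  ip (fun x => \sum_(i <- s) f i x) h = \sum_(i <- s) ip (f i) h.
Proof.
move=> sf sh; rewrite /ip -Rintegral_sum; last by move=> i; exact: sqint_mul.
by apply: eq_Rintegral => x _; rewrite mulr_suml.
Qed.

Lemma ip_ge0 f : 0 <= ip f f.
Proof. by apply: Rintegral_ge0 => x _; rewrite -expr2 sqr_ge0. Qed.

(* Nonnegativity of the square norm of the residual [f - w^-1 * \sum (ip f (e i)) e i]. *)
Lemma bessel (I : eqType) (s : seq I) (e : I -> X -> R) (w : R) f :
  0 < w -> uniq s -> (forall i, sqint (e i)) -> sqint f ->
  (forall i j, ip (e i) (e j) = w * (i == j)%:R) ->
  w^-1 * \sum_(i <- s) (ip f (e i)) ^+ 2 <= ip f f.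
Proof.
move=> w0 us se sf eij.
pose p x := \sum_(i <- s) (ip f (e i) / w) * e i x.
have sp : sqint p by apply: sqint_sum => i; exact: sqintZ.
have fp : ip f p = w^-1 * \sum_(i <- s) (ip f (e i)) ^+ 2.
  rewrite ipC ip_suml//; last by move=> i; exact: sqintZ.
  rewrite mulr_sumr; apply: eq_bigr => i _; rewrite ipZl// ipC; field.
  exact: lt0r_neq0.
(* [p] is the orthogonal projection of [f]: the residual is orthogonal to it. *)
have pp : ip p p = ip f p.
  rewrite {1}/p ip_suml//; last by move=> i; exact: sqintZ.
  rewrite fp mulr_sumr; rewrite !big_seq; apply: eq_bigr => i si; rewrite ipZl//.
  rewrite [ip (e i) p]ipC {1}/p ip_suml//; last by move=> j; exact: sqintZ.
  rewrite (bigD1_seq i)//= ipZl// eij eqxx big1 ?addr0; last first.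
    by move=> j ji; rewrite ipZl// eij (negbTE ji) !mulr0.
  by rewrite (_ : true%:R = 1 :> R)//; field; exact: lt0r_neq0.
have := ip_ge0 (fun x => f x - p x).
have sfp := sqintB sf sp.
rewrite (ipBl sf sp sfp) (ipC f) (ipC p) (ipBl sf sp sf) (ipBl sf sp sp).
by rewrite (ipC p f) pp fp; lra.
Qed.

End RealIntegrable.

Section FTC.
Variable R : realType.
Local Notation mu := (@lebesgue_measure R).

Lemma continuous_itv_integrable (f : R -> R) (x y : R) : continuous f ->
  mu.-integrable `[x, y] (EFin \o f).
Proof.
move=> cf; apply: continuous_compact_integrable; first exact: segment_compact.
exact: continuous_subspaceT.
Qed.

Lemma Rintegral_FTC (f F : R -> R) (x y : R) : x <= y -> continuous f ->
  (forall t : R, is_derive t (1 : R) F (f t)) ->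
  \int[mu]_(t in `[x, y]) f t = F y - F x.
Proof.
rewrite le_eqVlt => /predU1P[-> _ _|xy cf dF].
  by rewrite set_itv1 Rintegral_set1 subrr.
have cF t : {for t, continuous F}.
  by apply: differentiable_continuous; apply/derivable1_diffP.
rewrite /Rintegral (@continuous_FTC2 R f F x y)//.
- exact: continuous_subspaceT.
- split => //; first exact: (cvg_at_right_filter (cF x)).
  exact: (cvg_at_left_filter (cF y)).
- by move=> t _; rewrite derive1E derive_val.
Qed.
End FTC.

(** * Orthogonality of the Hartley functions *)

Section TrigonometricSystem.
Variables (R : realType) (b : R).
Hypothesis hb : 0 < b.
Local Notation mu := (@lebesgue_measure R).
Local Notation T := (b^-1).
Local Notation I := `[0, b^-1]%classic.
Implicit Types (m n k : int) (f h : R -> R).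

Let T0 : 0 < T. Proof. by rewrite invr_gt0. Qed.
Let mI : measurable (I : set (measurableTypeR R)). Proof. exact: measurable_itv. Qed.
Let muIE : mu I = T%:E.
Proof. by rewrite lebesgue_measure_itv/= lte_fin T0 -EFinD subr0. Qed.

Definition freq m : R := 2 * pi * b * m%:~R.

Lemma freqB m n : freq (m - n) = freq m - freq n.
Proof. by rewrite /freq intrB mulrBr. Qed.
Lemma freqD m n : freq (m + n) = freq m + freq n.
Proof. by rewrite /freq intrD mulrDr. Qed.
Lemma freqN m : freq (- m) = - freq m.
Proof. by rewrite /freq intrN mulrN. Qed.

Lemma freq_eq0 m : (freq m == 0) = (m == 0).
Proof. by rewrite /freq mulf_eq0 intr_eq0 gt_eqF// !mulr_gt0 ?pi_gt0. Qed.

Lemma cosD_period k (x : R) : cos (x + 2 * pi * k%:~R) = cos x.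
Proof.
case: k => n.
  by rewrite -[RHS](periodicn (@cosD2pi R) n); congr cos; rewrite -mulr_natr; ring.
rewrite NegzE -[LHS](periodicn (@cosD2pi R) n.+1); congr cos.
by rewrite intrN -(mulr_natr _ n.+1) mulr2n; ring.
Qed.

Lemma sinD_period k (x : R) : sin (x + 2 * pi * k%:~R) = sin x.
Proof.
case: k => n.
  by rewrite -[RHS](periodicn (@sinD2pi R) n); congr sin; rewrite -mulr_natr; ring.
rewrite NegzE -[LHS](periodicn (@sinD2pi R) n.+1); congr sin.
by rewrite intrN -(mulr_natr _ n.+1) mulr2n; ring.
Qed.

Lemma cos_freqD m k (x : R) : cos (freq m * (x + k%:~R / b)) = cos (freq m * x).
Proof.
rewrite -[RHS](cosD_period (m * k)); congr cos; rewrite /freq intrM.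
have : b != 0 by rewrite gt_eqF.
by move: (pi : R) => p b0; field.
Qed.

Lemma sin_freqD m k (x : R) : sin (freq m * (x + k%:~R / b)) = sin (freq m * x).
Proof.
rewrite -[RHS](sinD_period (m * k)); congr sin; rewrite /freq intrM.
have : b != 0 by rewrite gt_eqF.
by move: (pi : R) => p b0; field.
Qed.

Let cos_freqT m : cos (freq m * T) = 1.
Proof. by have := cos_freqD m 1 0; rewrite add0r mulr0 cos0 mul1r. Qed.
Let sin_freqT m : sin (freq m * T) = 0.
Proof. by have := sin_freqD m 1 0; rewrite add0r mulr0 sin0 mul1r. Qed.

Lemma continuous_cosM (c : R) : continuous (fun x : R => cos (c * x)).
Proof.
by move=> x; apply: (@continuous_comp _ _ _ (fun x : R => c * x) cos);
  [exact: mulrl_continuous|exact: continuous_cos].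
Qed.
Lemma continuous_sinM (c : R) : continuous (fun x : R => sin (c * x)).
Proof.
by move=> x; apply: (@continuous_comp _ _ _ (fun x : R => c * x) sin);
  [exact: mulrl_continuous|exact: continuous_sin].
Qed.

Lemma is_derive_cosM (c t : R) : is_derive t (1 : R) (fun x : R => cos (c * x)) (- c * sin (c * t)).
Proof.
have H : is_derive t (1 : R) (fun x : R => c * x) c.
  by apply: is_derive_eq; rewrite /GRing.scale/=; ring.
by rewrite mulNr mulrC -mulNr; exact: (is_derive1_comp (is_derive_cos (c * t)) H).
Qed.

Lemma is_derive_sinM (c t : R) : is_derive t (1 : R) (fun x : R => sin (c * x)) (c * cos (c * t)).
Proof.
have H : is_derive t (1 : R) (fun x : R => c * x) c.
  by apply: is_derive_eq; rewrite /GRing.scale/=; ring.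
by rewrite mulrC; exact: (is_derive1_comp (is_derive_sin (c * t)) H).
Qed.

Let int_cos k : \int[mu]_(x in I) cos (freq k * x) = T * (k == 0)%:R.
Proof.
have [->|k0] := eqVneq k 0.
  rewrite (_ : freq 0 = 0); last by apply/eqP; rewrite freq_eq0.
  under eq_Rintegral do rewrite mul0r cos0.
  by rewrite Rintegral_cst// mul1r mulr1 [X in fine X]muIE.
rewrite mulr0.
have dF (t : R) : is_derive t (1 : R) (fun x : R => (freq k)^-1 * sin (freq k * x)) (cos (freq k * t)).
  apply: (is_derive_eq (is_deriveZ (freq k)^-1 (is_derive_sinM (freq k) t))).
  by rewrite /GRing.scale/= mulKf// freq_eq0.
rewrite (Rintegral_FTC (ltW T0) _ dF)//; last exact: continuous_cosM.
by rewrite sin_freqT !mulr0 sin0 mulr0 subrr.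
Qed.

Let int_sin k : \int[mu]_(x in I) sin (freq k * x) = 0.
Proof.
have [->|k0] := eqVneq k 0.
  rewrite (_ : freq 0 = 0); last by apply/eqP; rewrite freq_eq0.
  under eq_Rintegral do rewrite mul0r sin0.
  by rewrite Rintegral_cst// mul0r.
have dF (t : R) : is_derive t (1 : R) (fun x : R => (- (freq k)^-1) * cos (freq k * x)) (sin (freq k * t)).
  apply: (is_derive_eq (is_deriveZ (- (freq k)^-1) (is_derive_cosM (freq k) t))).
  by rewrite /GRing.scale/= mulrA mulrNN mulVf ?mul1r// freq_eq0.
rewrite (Rintegral_FTC (ltW T0) _ dF)//; last exact: continuous_sinM.
by rewrite cos_freqT mulr0 cos0 subrr.
Qed.

(* The Hartley functions: a real orthogonal basis, in which the sum of the squared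
   coefficients of indices m and -m is the same as for the complex exponentials. *)
Definition cas m (x : R) : R := cos (freq m * x) + sin (freq m * x).

Lemma continuous_cas m : continuous (cas m).
Proof. by move=> x; apply: cvgD; [exact: continuous_cosM|exact: continuous_sinM]. Qed.

Lemma continuous_sqint f : continuous f -> sqint mu I f.
Proof.
move=> cf; split.
  by apply: measurable_funTS; exact: continuous_measurable_fun.
by apply: continuous_itv_integrable => x; apply: cvgM; exact: cf.
Qed.

Lemma sqint_cas m : sqint mu I (cas m).
Proof. exact/continuous_sqint/continuous_cas. Qed.

(** The product of two Hartley functions is a cosine of the frequency difference plus a sine of the
    frequency sum; the sine always integrates to 0 over a period, the cosine unless [m = n]. *)
Lemma ip_cas m n : ip mu I (cas m) (cas n) = T * (m == n)%:R.
Proof.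
rewrite /ip.
transitivity (\int[mu]_(x in I) (cos (freq (m - n) * x) + sin (freq (m + n) * x))).
  apply: eq_Rintegral => x _; rewrite freqB freqD.
  have key (y z : R) : (cos y + sin y) * (cos z + sin z) = cos (y - z) + sin (y + z).
    by rewrite cosB sinD; ring.
  by rewrite /cas key mulrBl mulrDl.
rewrite RintegralD//; last 2 first.
- apply: continuous_itv_integrable; exact: continuous_cosM.
- apply: continuous_itv_integrable; exact: continuous_sinM.
by rewrite int_cos int_sin addr0 subr_eq0.
Qed.

End TrigonometricSystem.

(** * Unordered sums of extended reals *)

Section Esum.
Context {R : realType} {T : choiceType}.
Implicit Types (D : set T) (a : T -> \bar R).
Local Open Scope ereal_scope.

Lemma esum_le_fset D a (M : \bar R) :
  (forall s : {fset T}, [set` s] `<=` D -> \sum_(i <- s) a i <= M) ->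
  \esum_(i in D) a i <= M.
Proof.
move=> H; apply: ge_ereal_sup => _ [A [finA AD] <-].
by rewrite fsbig_finite//; apply: H => i /=; rewrite in_fset_set// inE; exact: AD.
Qed.

Lemma sum_le_esum D a (s : {fset T}) : [set` s] `<=` D ->
  \sum_(i <- s) a i <= \esum_(i in D) a i.
Proof.
move=> sD; apply: ereal_sup_ubound; exists [set` s]; first by split.
by rewrite fsbig_finite//= set_fsetK.
Qed.

Lemma esumZl (c : R) D a : (0 <= c)%R -> (forall i, D i -> 0 <= a i) ->
  \esum_(i in D) (c%:E * a i) = c%:E * \esum_(i in D) a i.
Proof.
move=> c0 a0.
(* One inequality suffices: the other is the same one for the factor [c^-1]. *)
have le (e : R) u : (0 <= e)%R -> (forall i, D i -> 0 <= u i) ->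
    \esum_(i in D) (e%:E * u i) <= e%:E * \esum_(i in D) u i.
  move=> e0 u0; apply: esum_le_fset => s sD.
  rewrite big_seq -ge0_sume_distrr; last by move=> i si; apply/u0/sD.
  by rewrite -big_seq lee_wpmul2l// sum_le_esum.
move: c0; rewrite le_eqVlt => /predU1P[<-|c0].
  by rewrite mul0e esum1// => i _; rewrite mul0e.
apply/eqP; rewrite eq_le le ?(ltW c0)//=.
rewrite -[leRHS]mul1e -(divff (lt0r_neq0 c0)) EFinM -muleA lee_pmul2l// .
rewrite -[leLHS](_ : \esum_(i in D) ((c^-1)%:E * (c%:E * a i)) = _).
  apply: le; first by rewrite invr_ge0 ltW.
  by move=> i Di; rewrite mule_ge0 ?a0// lee_fin ltW.
by apply: eq_esum => i _; rewrite muleA -EFinM mulVf ?mul1e// lt0r_neq0.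
Qed.
End Esum.

Section EsumInt.
Context {R : realType}.
Implicit Types a : int -> \bar R.
Local Open Scope ereal_scope.

Lemma esum_intN a : \esum_(m in [set: int]) a (- m)%R = \esum_(m in [set: int]) a m.
Proof.
symmetry; apply: reindex_esum; split; [by []|by move=> m n _ _; exact: oppr_inj|].
by move=> m _; exists (- m)%R => //; rewrite opprK.
Qed.

(** Twice each sum is the sum of the paired terms, and x + x determines x in [0, +oo]. This is the
    tool for comparing Fourier-type coefficients that agree only after pairing m with -m. *)
Lemma esum_int_symm a a' : (forall m, 0 <= a m) -> (forall m, 0 <= a' m) ->
  (forall m, a m + a (- m)%R = a' m + a' (- m)%R) ->
  \esum_(m in [set: int]) a m = \esum_(m in [set: int]) a' m.
Proof.
move=> a0 a'0 aa'.
have : \esum_(m in [set: int]) a m + \esum_(m in [set: int]) a m =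
       \esum_(m in [set: int]) a' m + \esum_(m in [set: int]) a' m.
  rewrite -{2}(esum_intN a) -{2}(esum_intN a') -!esumD//.
  by apply: eq_esum => m _; exact: aa'.
have : 0 <= \esum_(m in [set: int]) a m by exact: esum_ge0.
have : 0 <= \esum_(m in [set: int]) a' m by exact: esum_ge0.
case: (esum _ a) => [r||]; case: (esum _ a') => [r'||]// _ _ [].
by move=> e; congr EFin; lra.
Qed.

Lemma esum_int_split a : (forall m, 0 <= a m) ->
  \esum_(m in [set: int]) a m =
  \sum_(0 <= n <oo) a (Posz n) + \sum_(0 <= n <oo) a (Negz n).
Proof.
move=> a0.
rewrite (esumID (range Posz))//; congr (_ + _); rewrite setTI.
  by rewrite esum_image ?nneseries_esumT// => m n _ _ [].
rewrite (_ : ~` _ = range Negz); first by rewrite esum_image ?nneseries_esumT// => m n _ _ [].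
by apply/seteqP; split => [[n|n] H|_ [n _ <-] [m _]]//=; [case: H; exists n|exists n].
Qed.

End EsumInt.

(** * The closed subspace on which Parseval's identity holds *)

Section ParsevalSubspace.
Context d (X : measurableType d) (R : realType).
Variables (mu : {measure set X -> \bar R}) (D : set X).
Hypothesis mD : measurable D.
Variables (J : choiceType) (e : J -> X -> R) (w : R).
Hypothesis w0 : 0 < w.
Hypothesis se : forall j, sqint mu D (e j).
Hypothesis eij : forall i j, ip mu D (e i) (e j) = w * (i == j)%:R.
Implicit Types f h : X -> R.
Local Notation ip := (ip mu D).
Local Notation sqint := (sqint mu D).

Definition energy f : \bar R := \esum_(j in [set: J]) ((ip f (e j)) ^+ 2)%:E.

Let energy_ge0 f : (0 <= energy f)%E.
Proof. by apply: esum_ge0 => m _; rewrite lee_fin sqr_ge0. Qed.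

Let energy_le f : sqint f -> (energy f <= (w * ip f f)%:E)%E.
Proof.
move=> sf; apply: esum_le_fset => s _; rewrite sumEFin lee_fin.
have := bessel mD w0 (fset_uniq s) se sf eij.
by rewrite mulrC ler_pdivrMr// mulrC.
Qed.

Let energy_fin f : sqint f -> energy f = (fine (energy f))%:E.
Proof.
move=> sf; rewrite fineK// ge0_fin_numE//.
by rewrite (le_lt_trans (energy_le sf))// ltry.
Qed.

(* By Bessel's inequality [defect] is a nonnegative quadratic form, so that its
   zeros form a closed linear subspace. *)
Let defect f : R := w * ip f f - fine (energy f).

Let defect_ge0 f : sqint f -> 0 <= defect f.
Proof. by move=> sf; rewrite subr_ge0 -lee_fin -energy_fin// energy_le. Qed.

Let defect_le f : sqint f -> defect f <= w * ip f f.
Proof. by move=> sf; rewrite lerBlDr lerDl fine_ge0. Qed.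

Let ipDD f h : sqint f -> sqint h ->
  ip (fun x => f x + h x) (fun x => f x + h x) = ip f f + ip h h + 2 * ip f h.
Proof.
move=> sf sh; have sfh := sqintD mD sf sh.
rewrite (ipDl mD sf sh sfh) (ipC _ _ f) (ipC _ _ h) (ipDl mD sf sh sf) (ipDl mD sf sh sh).
by rewrite (ipC _ _ h f); ring.
Qed.

Let ipBB f h : sqint f -> sqint h ->
  ip (fun x => f x - h x) (fun x => f x - h x) = ip f f + ip h h - 2 * ip f h.
Proof.
move=> sf sh; have sfh := sqintB mD sf sh.
rewrite (ipBl mD sf sh sfh) (ipC _ _ f) (ipC _ _ h) (ipBl mD sf sh sf) (ipBl mD sf sh sh).
by rewrite (ipC _ _ h f); ring.
Qed.

Let energyDB f h : sqint f -> sqint h ->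
  (energy (fun x => (f x + h x)%R) + energy (fun x => (f x - h x)%R) =
   (energy f + energy f) + (energy h + energy h))%E.
Proof.
move=> sf sh; rewrite /energy -!esumD//; do ?by move=> m _; rewrite lee_fin ?addr_ge0 ?sqr_ge0.
apply: eq_esum => m _; rewrite (ipDl mD sf sh (se m)) (ipBl mD sf sh (se m)).
by rewrite -!EFinD; congr EFin; ring.
Qed.

(** The parallelogram law replaces bilinearity, which would require summing products of coefficients
    of varying sign. *)
Let defectDB f h : sqint f -> sqint h ->
  defect (fun x => f x + h x) + defect (fun x => f x - h x) = 2 * defect f + 2 * defect h.
Proof.
move=> sf sh; have := energyDB sf sh.
have sD := sqintD mD sf sh; have sB := sqintB mD sf sh.
rewrite (energy_fin sD) (energy_fin sB) (energy_fin sf) (energy_fin sh) -!EFinD => -[E].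
rewrite /defect (ipDD sf sh) (ipBB sf sh) addrACA -opprD E.
by move: (fine _) (fine _) => u v; ring.
Qed.

Definition parseval f := sqint f /\ energy f = (w * ip f f)%:E.

Let parsevalP f : parseval f <-> sqint f /\ defect f = 0.
Proof.
rewrite /parseval /defect; split=> -[sf]; first by move=> ->; rewrite subrr.
by move/eqP; rewrite subr_eq0 => /eqP ->; rewrite -energy_fin.
Qed.

(** By the parallelogram law the defects of [f + h] and [f - h] add up to 0, and both are
    nonnegative. *)
Lemma parsevalD f h : parseval f -> parseval h -> parseval (fun x => f x + h x).
Proof.
move=> /parsevalP[sf df] /parsevalP[sh dh]; apply/parsevalP.
have sD := sqintD mD sf sh; have sB := sqintB mD sf sh.
split => //; have := defectDB sf sh; rewrite df dh.
have := defect_ge0 sD; have := defect_ge0 sB.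
by move: (defect _) (defect _) => u v; lra.
Qed.

Lemma parsevalB f h : parseval f -> parseval h -> parseval (fun x => f x - h x).
Proof.
move=> /parsevalP[sf df] /parsevalP[sh dh]; apply/parsevalP.
have sD := sqintD mD sf sh; have sB := sqintB mD sf sh.
split => //; have := defectDB sf sh; rewrite df dh.
have := defect_ge0 sD; have := defect_ge0 sB.
by move: (defect _) (defect _) => u v; lra.
Qed.

Lemma parsevalZ c f : parseval f -> parseval (fun x => c * f x).
Proof.
move=> [sf ef]; have sZ := sqintZ mD c sf; split => //.
have -> : energy (fun x => c * f x) = ((c ^+ 2)%:E * energy f)%E.
  rewrite /energy -esumZl ?sqr_ge0//; last by move=> m _; rewrite lee_fin sqr_ge0.
  by apply: eq_esum => m _; rewrite (ipZl mD c sf (se m)) exprMn.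
rewrite ef -EFinM (ipZl mD c sf sZ) (ipC _ _ f) (ipZl mD c sf sf).
by congr EFin; ring.
Qed.

Lemma parseval_sum (I : Type) (s : seq I) (f : I -> X -> R) :
  (forall i, parseval (f i)) -> parseval (fun x => \sum_(i <- s) f i x).
Proof.
move=> pf; elim: s => [|i s ih].
  have -> : (fun x => \sum_(i <- [::]) f i x) = (fun x => 0 * 0).
    by apply/funext => x; rewrite big_nil mul0r.
  apply: (parsevalZ 0 (f := fun=> 0)).
  have s0 : sqint (fun=> 0).
    by split => //; under [X in _ \o X]eq_fun do rewrite expr0n; exact: integrable0.
  have z h : sqint h -> ip (fun=> 0) h = 0.
    by move=> sh; rewrite /ip; under eq_Rintegral do rewrite mul0r; rewrite /Rintegral integral0.
  split => //; rewrite z// mulr0 /energy esum1// => j _.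
  by rewrite z// expr0n.
have -> : (fun x => \sum_(j <- i :: s) f j x) = (fun x => f i x + \sum_(j <- s) f j x).
  by apply/funext => x; rewrite big_cons.
exact: parsevalD.
Qed.

Lemma parseval_closed f : sqint f ->
  (forall eps, 0 < eps -> exists2 h, parseval h &
    ip (fun x => f x - h x) (fun x => f x - h x) <= eps) ->
  parseval f.
Proof.
move=> sf H; apply/parsevalP; split => //; apply/eqP; rewrite eq_le defect_ge0// andbT.
apply/ler_addgt0Pr => eps e0; rewrite add0r.
have w2 : 0 < 2 * w by rewrite mulr_gt0.
have [h /parsevalP[sh dh] hh] := H (eps / (2 * w)) (divr_gt0 e0 w2).
have sB := sqintB mD sf sh.
(* Applied to [h] and [f - h], whose sum is [f]: the defect of [f] is at most twice that of [f - h],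
   hence at most [2 * w] times the squared distance. This explains the choice [eps / (2 * w)]. *)
have := defectDB sh sB.
rewrite (_ : (fun x => h x + (f x - h x)) = f); last by apply/funext => x; ring.
have := defect_ge0 (sqintB mD sh sB); have := defect_le sB; rewrite dh.
have : w * ip (fun x => f x - h x) (fun x => f x - h x) <= eps / 2.
  apply: (le_trans (ler_wpM2l (ltW w0) hh)); rewrite (_ : w * _ = eps / 2)//.
  by field; rewrite gt_eqF.
by move: (defect _) (defect _) (defect _) (w * _) => u v y z; lra.
Qed.

Let ip_ae f f' h h' : measurable_fun D f -> measurable_fun D f' ->
  measurable_fun D h -> measurable_fun D h' ->
  ae_eq mu D f f' -> ae_eq mu D h h' -> ip f h = ip f' h'.
Proof.
move=> mf mf' mh mh' ff' hh'; rewrite /ip; congr fine; apply: ae_eq_integral => //.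
- by apply/measurable_EFinP; exact: measurable_funM.
- by apply/measurable_EFinP; exact: measurable_funM.
- by near=> x => Dx; rewrite (near ff' x)// (near hh' x).
Unshelve. all: by end_near. Qed.

Lemma parseval_ae f h : measurable_fun D h -> ae_eq mu D f h -> parseval f -> parseval h.
Proof.
move=> mh fh [[mf sf] ef].
have hf : ae_eq mu D h f by near=> x => Dx; rewrite (near fh x).
split.
  split => //; apply/integrableP; split.
    by apply/measurable_EFinP; exact: measurable_funX.
  move/integrableP : sf => [_]; apply: le_lt_trans; rewrite le_eqVlt; apply/orP; left; apply/eqP.
  apply: ge0_ae_eq_integral => //.
  - by apply/measurableT_comp => //; apply/measurable_EFinP; exact: measurable_funX.
  - by apply/measurableT_comp => //; apply/measurable_EFinP; exact: measurable_funX.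
  - by near=> x => Dx /=; rewrite (near hf x).
rewrite (ip_ae mh mf mh mf hf hf) -ef; apply: eq_esum => j _.
by rewrite (ip_ae mh mf (se j).1 (se j).1 hf)//; near=> x.
Unshelve. all: by end_near. Qed.

Lemma parseval_basis j : parseval (e j).
Proof.
split => //; rewrite /energy (esumID [set j])//; last by move=> i _; rewrite lee_fin sqr_ge0.
rewrite setTI esum_set1 ?lee_fin ?sqr_ge0// esum1; last first.
  move=> i [_ /= /eqP ij]; rewrite eij eq_sym (negbTE ij) mulr0 expr0n//.
by rewrite adde0 eij eqxx (_ : true%:R = 1 :> R)// mulr1 expr2.
Qed.

(** Dominated convergence for the squared errors turns pointwise convergence into the mean-square
    approximation that [parseval_closed] asks for. *)
Lemma parseval_dominated f (h : nat -> X -> R) (G : X -> R) : sqint f ->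
  (forall n, parseval (h n)) -> (forall x, D x -> h n x @[n --> \oo] --> f x) ->
  (forall n x, D x -> (f x - h n x) ^+ 2 <= G x) -> mu.-integrable D (EFin \o G) ->
  parseval f.
Proof.
move=> sf ph hf hG iG; apply: parseval_closed => // eps eps0.
have sB n := sqintB mD sf (ph n).1.
have [||||_ _ /=] := @dominated_convergence _ _ R mu D mD
    (fun n x => ((f x - h n x) ^+ 2)%:E) (cst 0%E) (EFin \o G) _ _ _ iG.
- by move=> n; apply/measurable_EFinP/measurable_funX; exact: (sB n).1.
- exact: measurable_cst.
- apply: aeW => x Dx; apply: cvg_EFin; first exact: nearW.
  have fh : f x - h n x @[n --> \oo] --> f x - f x by apply: cvgB; [exact: cvg_cst|exact: hf].
  have := cvgM fh fh; rewrite subrr mul0r; exact.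
- apply: aeW => x n Dx; rewrite gee0_abs ?lee_fin ?sqr_ge0//; exact: hG.
rewrite integral0 => /fine_cvgP[_ /cvgrPdist_le /(_ _ eps0)[N _ /(_ N)]].
rewrite /= leqnn sub0r normrN => /(_ isT) le.
exists (h N) => //; apply: le_trans le.
by rewrite /ip /Rintegral; under eq_integral do rewrite -expr2; exact: ler_norm.
Qed.

End ParsevalSubspace.

Import HBNNSimple.

(** * Completeness of the Hartley functions *)

Section Parseval.
Variables (R : realType) (b : R).
Hypothesis hb : 0 < b.
Local Notation mu := (@lebesgue_measure R).
Local Notation T := (b^-1).
Local Notation I := `[0, b^-1]%classic.
Local Notation cas := (cas b).
Implicit Types (m n k : int) (f h : R -> R).

Let T0 : 0 < T. Proof. by rewrite invr_gt0. Qed.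
Let mI : measurable (I : set (measurableTypeR R)). Proof. exact: measurable_itv. Qed.
Let muIE : mu I = T%:E.
Proof. by rewrite lebesgue_measure_itv/= lte_fin T0 -EFinD subr0. Qed.

Local Notation good := (parseval mu I cas T).

(* The 1/b-periodic sawtooth with a single jump at [t]; the coefficients of index m
   and -m have squares adding up to [2 * (T / freq m) ^ 2], independently of [t]. *)
Let saw (t x : R) : R := x - t + T / 2 - T * \1_`]t, +oo[ x.

Let saw_sqint t : sqint mu I (saw t).
Proof.
apply: (sqintB mI); first by apply: continuous_sqint; move=> x; apply: cvgD; [apply: cvgB; [exact: cvg_id|exact: cvg_cst]|exact: cvg_cst].
apply: (sqintZ mI); apply: (@sqint_bounded _ _ _ _ _ mI _ 1).
- by rewrite [X in (X < _)%E]muIE ltry.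
- by apply: measurable_funTS; exact: measurable_indic.
- by move=> x _; rewrite indicE; case: (_ \in _); rewrite ?normr1 ?normr0.
Qed.

(** Replaces an integrand with a jump at [t] by continuous ones on closed intervals, to which the
    fundamental theorem of calculus applies. *)
Let Rint_split (f f1 f2 : R -> R) t : 0 <= t <= T ->
  mu.-integrable I (EFin \o f) -> continuous f1 -> continuous f2 ->
  (forall x, x <= t -> f x = f1 x) -> (forall x, t < x -> f x = f2 x) ->
  \int[mu]_(x in I) f x = \int[mu]_(x in `[0, t]) f1 x + \int[mu]_(x in `[t, T]) f2 x.
Proof.
move=> /andP[t0 tT] fi c1 c2 e1 e2.
have := @Rintegral_itvB R f (BLeft 0) (BRight T) t fi.
rewrite !bnd_simp => /(_ t0 tT) E.
rewrite -[LHS](subrK (\int[mu]_(t0 in [set` Interval (BLeft 0) (BRight t)]) f t0)) E addrC; congr (_ + _).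
  by apply: eq_Rintegral => x; rewrite inE/= in_itv/= => /andP[_ xt]; exact: e1.
rewrite -(Rintegral_itv_obnd_cbnd (f := f2)); last first.
  apply: integrableS (continuous_itv_integrable t T c2) => //.
  exact: subset_itv_oc_cc.
by apply: eq_Rintegral => x; rewrite inE/= in_itv/= => /andP[xt _]; exact: e2.
Qed.

Let sawE1 t x : x <= t -> saw t x = x - t + T / 2.
Proof.
move=> xt; rewrite /saw indicE memNset ?mulr0 ?subr0//.
by rewrite /= in_itv/= andbT => /lt_geF; rewrite xt.
Qed.

Let sawE2 t x : t < x -> saw t x = x - t - T / 2.
Proof.
move=> xt; rewrite /saw indicE mem_set ?mulr1; first by field; rewrite gt_eqF.
by rewrite /= in_itv/= andbT.
Qed.

(** [saw t] is a periodic translate of the centred ramp, so this is the integral of y^2 over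
    [-T/2, T/2]. *)
Let saw_norm t : 0 <= t <= T -> ip mu I (saw t) (saw t) = T ^+ 3 / 12.
Proof.
move=> tT; rewrite /ip.
pose f1 (x : R) := (x - t + T / 2) ^+ 2.
pose f2 (x : R) := (x - t - T / 2) ^+ 2.
have d1 (x : R) : is_derive x (1 : R) (fun x : R => 3^-1 * (x - t + T / 2) ^+ 3) (f1 x).
  by apply: is_derive_eq; rewrite /f1 /GRing.scale/=; field; rewrite gt_eqF.
have d2 (x : R) : is_derive x (1 : R) (fun x : R => 3^-1 * (x - t - T / 2) ^+ 3) (f2 x).
  by apply: is_derive_eq; rewrite /f2 /GRing.scale/=; field; rewrite gt_eqF.
have c1 : continuous f1.
  by move=> x; apply: differentiable_continuous; apply/derivable1_diffP.
have c2 : continuous f2.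
  by move=> x; apply: differentiable_continuous; apply/derivable1_diffP.
have /andP[t0 tT'] := tT.
rewrite (@Rint_split _ f1 f2 t)//; last 3 first.
- exact: (saw_sqint t).2.
- by move=> x xt; rewrite sawE1// -expr2.
- by move=> x xt; rewrite sawE2// -expr2.
rewrite (Rintegral_FTC t0 c1 d1) (Rintegral_FTC tT' c2 d2).
by field; rewrite gt_eqF.
Qed.

(** The constant [T / 2] in [saw] is there to make the mean vanish. *)
Let saw_coef0 t : 0 <= t <= T -> ip mu I (saw t) (cas 0) = 0.
Proof.
move=> tT; rewrite /ip.
pose f1 (x : R) := x - t + T / 2.
pose f2 (x : R) := x - t - T / 2.
have d1 (x : R) : is_derive x (1 : R) (fun x : R => 2^-1 * (x - t + T / 2) ^+ 2) (f1 x).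
  by apply: is_derive_eq; rewrite /f1 /GRing.scale/=; field; rewrite gt_eqF.
have d2 (x : R) : is_derive x (1 : R) (fun x : R => 2^-1 * (x - t - T / 2) ^+ 2) (f2 x).
  by apply: is_derive_eq; rewrite /f2 /GRing.scale/=; field; rewrite gt_eqF.
have c1 : continuous f1.
  by move=> x; apply: differentiable_continuous; apply/derivable1_diffP.
have c2 : continuous f2.
  by move=> x; apply: differentiable_continuous; apply/derivable1_diffP.
have /andP[t0 tT'] := tT.
have cas0 (x : R) : cas 0 x = 1.
  by rewrite /cas (_ : freq b 0 = 0) ?mul0r ?cos0 ?sin0 ?addr0//; apply/eqP; rewrite freq_eq0.
rewrite (@Rint_split _ f1 f2 t)//; last 3 first.
- by apply: (sqint_mul mI); [exact: saw_sqint|exact: sqint_cas].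
- by move=> x xt; rewrite cas0 mulr1 sawE1.
- by move=> x xt; rewrite cas0 mulr1 sawE2.
rewrite (Rintegral_FTC t0 c1 d1) (Rintegral_FTC tT' c2 d2).
by field; rewrite gt_eqF.
Qed.

Let saw_coef t m : 0 <= t <= T -> m != 0 ->
  ip mu I (saw t) (cas m) = T * (sin (freq b m * t) - cos (freq b m * t)) / freq b m.
Proof.
move=> tT m0; rewrite /ip.
have w0 : freq b m != 0 by rewrite freq_eq0.
(* The antiderivative of [(x - c) * cas m x] given by integration by parts; the two branches of
   [saw t] are [x - c] with [c = t - T / 2] and [c = t + T / 2]. *)
pose F c (x : R) := (x - c) * ((freq b m)^-1 * (sin (freq b m * x) - cos (freq b m * x))) +
  (freq b m) ^- 2 * (cos (freq b m * x) + sin (freq b m * x)).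
have dF c (x : R) : is_derive x (1 : R) (F c) ((x - c) * cas m x).
  have ds := is_derive_sinM (freq b m) x.
  have dc := is_derive_cosM (freq b m) x.
  by apply: is_derive_eq; rewrite /cas /GRing.scale/=; field.
have cF c : continuous (fun x : R => (x - c) * cas m x).
  by move=> x; apply: cvgM; [apply: cvgB; [exact: cvg_id|exact: cvg_cst]|exact: continuous_cas].
have /andP[t0 tT'] := tT.
rewrite (@Rint_split _ (fun x : R => (x - (t - T / 2)) * cas m x)
   (fun x : R => (x - (t + T / 2)) * cas m x) t)//; last 3 first.
- by apply: (sqint_mul mI); [exact: saw_sqint|exact: sqint_cas].
- by move=> x xt; rewrite sawE1//; congr (_ * _); ring.
- by move=> x xt; rewrite sawE2//; congr (_ * _); ring.
rewrite (Rintegral_FTC t0 (cF _) (dF _)) (Rintegral_FTC tT' (cF _) (dF _)).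
have ec : cos (freq b m * T) = 1.
  by have := cos_freqD hb m 1 0; rewrite add0r mulr0 cos0 mul1r.
have es : sin (freq b m * T) = 0.
  by have := sin_freqD hb m 1 0; rewrite add0r mulr0 sin0 mul1r.
rewrite /F ec es mulr0 cos0 sin0.
move: (cos (freq b m * t)) (sin (freq b m * t)) => C S.
by move: (freq b m) w0 => w w0; field; rewrite w0 gt_eqF.
Qed.

Let sum_freqN2 : (\esum_(m in [set: int]) (if m == 0 then 0 else (T / freq b m) ^+ 2)%R%:E =
  (T ^+ 4 / 12)%:E)%E.
Proof.
have a0 (m : int) : (0 <= (if m == 0 then 0 else (T / freq b m) ^+ 2)%R%:E)%E.
  by case: ifP => _; rewrite lee_fin// sqr_ge0.
have b0 : b != 0 by rewrite gt_eqF.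
have p0 : (pi : R) != 0 by rewrite gt_eqF// pi_gt0.
pose c : R := T ^+ 4 / (4 * pi ^+ 2).
have c0 : 0 <= c by rewrite divr_ge0 ?mulr_ge0 ?exprn_ge0 ?pi_ge0 ?(ltW T0).
have S : (\sum_(0 <= n <oo) (c * n.+1%:R ^- 2)%:E = (T ^+ 4 / 24)%:E)%E.
  under eq_eseriesr do rewrite EFinM.
  rewrite nneseriesZl ?basel; last by move=> n _; rewrite lee_fin invr_ge0 exprn_ge0.
  rewrite -EFinM /c; congr EFin.
  by move: (pi : R) p0 => p p0; field; rewrite b0 p0.
rewrite esum_int_split//.
(* The term of index 0 vanishes; once it is dropped both halves run over [n.+1], as [Negz n] is
   [- n.+1]. *)
rewrite nneseries_recl//= add0e -nneseries_addn//.
have E (n : nat) : ((T / freq b n.+1) ^+ 2 = c * n.+1%:R ^- 2).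
  have n0 : n.+1%:R != 0 :> R by [].
  rewrite /freq /c -pmulrn; move: (n.+1%:R : R) n0 (pi : R) p0 => y y0 p p0.
  by field; rewrite b0 p0 y0.
under eq_eseriesr => n _ do rewrite addn1 /= E.
under [X in (_ + X)%E]eq_eseriesr => n _ do rewrite NegzE freqN invrN mulrN sqrrN E.
by rewrite S -EFinD; congr EFin; field.
Qed.

Let good_saw t : 0 <= t <= T -> good (saw t).
Proof.
move=> tT; split; first exact: saw_sqint.
rewrite saw_norm// (_ : T * _ = T ^+ 4 / 12); last by field; rewrite gt_eqF.
rewrite -sum_freqN2 /energy; apply: esum_int_symm.
- by move=> m; rewrite lee_fin sqr_ge0.
- by move=> m; case: ifP => _; rewrite lee_fin// sqr_ge0.
move=> m; rewrite oppr_eq0 -!EFinD; have [->|m0] := eqVneq m 0.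
  by rewrite oppr0 saw_coef0// expr0n/= !addr0.
rewrite !saw_coef ?oppr_eq0// !freqN; congr EFin.
have := cos2Dsin2 (freq b m * t); rewrite !mulNr cosN sinN.
have : freq b m != 0 by rewrite freq_eq0.
move: (cos (freq b m * t)) (sin (freq b m * t)) => C S.
move: (freq b m) => w w0 CS.
(* The coefficients of m and -m are [T / w] times [S - C] and [S + C], whose squares add up to 2. *)
transitivity (2 * (T / w) ^+ 2 * (C ^+ 2 + S ^+ 2)).
  by field; rewrite w0 gt_eqF.
by rewrite CS; field; rewrite w0 gt_eqF.
Qed.

Let ocas m : sqint mu I (cas m). Proof. exact: sqint_cas. Qed.

Let bounded_sqint f (M : R) : measurable_fun I f -> (forall x, I x -> `|f x| <= M) ->
  sqint mu I f.
Proof.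
by move=> mf fM; apply: (sqint_bounded mI _ mf fM); rewrite [X in (X < _)%E]muIE ltry.
Qed.

Let good_eq f h : measurable_fun I h -> (forall x, I x -> f x = h x) -> good f -> good h.
Proof. by move=> mh fh; apply: (parseval_ae mI ocas) => //; exact: aeW. Qed.

Let good_cst (c : R) : good (fun=> c).
Proof.
have -> : (fun=> c) = (fun x : R => c * cas 0 x).
  apply/funext => x; rewrite /cas (_ : freq b 0 = 0); last by apply/eqP; rewrite freq_eq0.
  by rewrite mul0r cos0 sin0 addr0 mulr1.
apply: (parsevalZ mI ocas); apply: (parseval_basis ocas (ip_cas hb)).
Qed.

Let goodD f h : good f -> good h -> good (fun x => f x + h x).
Proof. exact: (parsevalD mI T0 ocas (ip_cas hb)). Qed.
Let goodB f h : good f -> good h -> good (fun x => f x - h x).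
Proof. exact: (parsevalB mI T0 ocas (ip_cas hb)). Qed.
Let goodZ c f : good f -> good (fun x => c * f x).
Proof. exact: (parsevalZ mI ocas). Qed.

(** On [I] the jump of [saw T] is never reached, so there [saw T] is the identity minus [T / 2]. *)
Let good_id : good (fun x => x).
Proof.
have TT : 0 <= T <= T by rewrite ltW//=.
apply: (good_eq _ _ (goodD (good_saw TT) (good_cst (T / 2)))).
  by apply: measurable_funTS; exact: measurable_id.
by move=> x; rewrite /= in_itv/= => /andP[_ xT]; rewrite sawE1//; field; rewrite gt_eqF.
Qed.

(** For [t] in [I], solve the definition of [saw t] for the indicator; for other [t] the indicator
    is constant on [I]. *)
Let good_itv t : good (\1_`]t, +oo[).
Proof.
have mt : measurable_fun I (\1_`]t, +oo[ : R -> R).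
  by apply: measurable_funTS; exact: measurable_indic.
have [t0|t0] := ltP t 0.
  apply: (good_eq mt _ (good_cst 1)) => x; rewrite /= in_itv/= => /andP[x0 _].
  by rewrite indicE mem_set//= in_itv/= andbT (lt_le_trans t0).
have [tT|tT] := ltP T t.
  apply: (good_eq mt _ (good_cst 0)) => x; rewrite /= in_itv/= => /andP[_ xT].
  by rewrite indicE memNset//= in_itv/= andbT => /lt_geF; rewrite (le_trans xT (ltW tT)).
have t0T : 0 <= t <= T by rewrite t0.
have := goodZ T^-1 (goodB (goodD (goodB good_id (good_cst t)) (good_cst (T / 2))) (good_saw t0T)).
apply: good_eq => // x _; rewrite /saw subKr mulrA mulVf ?mul1r// gt_eqF//.
Qed.

(** Open rays are stable under intersection and generate the Borel sets. For a disjoint union, the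
    indicators of the finite partial unions are eventually constant at each point, and the squared
    errors are bounded by 1. *)
Let good_indic (S : set R) : measurable S -> good (\1_S).
Proof.
have mI1 (A : set R) : measurable A -> measurable_fun I (\1_A : R -> R).
  by move=> mA; apply: measurable_funTS; exact: measurable_indic.
move=> mS; apply: (@dynkin_induction _ (measurableTypeR R) (@RGenOInfty.G R)
   (fun A : set R => good (\1_A))) => //.
- exact: RGenOInfty.measurableE.
- move=> _ _ [x ->] [y ->]; exists (Num.max x y).
  apply/seteqP; split => z; rewrite /= !in_itv/= !andbT gt_max.
    by move/andP.
  by move/andP.
- by rewrite indicT; exact: good_cst.
- by move=> _ [x ->]; exact: good_itv.
- move=> A mA gA; apply: (good_eq _ _ (goodB (good_cst 1) gA)).
    by apply: mI1; exact: measurableC.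
  by move=> x _; rewrite !indicE in_setC; case: (_ \in _); rewrite /= ?subr0 ?subrr.
- move=> F mF tF gF.
  have mUF : measurable (\bigcup_k F k) by exact: bigcup_measurable.
  pose h (n : nat) (x : R) : R := \1_(\bigcup_(k in `I_n) F k) x.
  have good_h (n : nat) : good (h n).
    elim: n => [|n ih].
      by rewrite /h II0 bigcup_set0 indic0; exact: good_cst.
    apply: (good_eq _ _ (goodD ih (gF n))).
      by apply: mI1; apply: bigcup_measurable => k _; exact: mF.
    move=> x _; rewrite /h IIS bigcup_setU bigcup_set1 !indicE in_setU.
    case: (boolP (x \in F n)); rewrite ?orbT ?orbF ?addr0// inE => Fnx.
    rewrite memNset ?add0r// => -[k /= kn Fkx].
    have /trivIsetP/(_ k n Logic.I Logic.I) := tF; rewrite ltn_eqF// => /(_ isT) E.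
    by have : set0 x by rewrite -E.
  apply: (@parseval_dominated _ _ _ mu _ mI _ cas T T0 ocas (ip_cas hb) _ h (fun=> 1)) => //.
  + apply: (@bounded_sqint _ 1); first exact: mI1.
    by move=> x _; rewrite indicE; case: (_ \in _); rewrite ?normr1 ?normr0.
  + move=> x _; have [[k _ Fkx]|nF] := pselect ((\bigcup_k F k) x).
      apply: cvg_near_cst; exists k.+1 => // n /= kn.
      by rewrite /h !indicE !mem_set//; exists k.
    apply: cvg_near_cst; apply: nearW => n.
    by rewrite /h !indicE !memNset// => -[k kn Fkx]; apply: nF; exists k.
  + move=> n x _; rewrite /h !indicE.
    case: (_ \in _); case: (_ \in _); rewrite ?subrr ?subr0 ?sub0r ?sqrrN ?expr1n ?expr0n//.
  + by apply: continuous_itv_integrable => x; exact: cvg_cst.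
- exact: (eq_ind _ (fun X : set (set R) => X S) mS _ (RGenOInfty.measurableE R)).
Qed.

Let good_nnsfun (f : {nnsfun (measurableTypeR R) >-> R}) : good f.
Proof.
have -> : (f : _ -> R) = (fun x => \sum_(y <- fset_set (range f)) y * \1_(f @^-1` [set y]) x).
  by apply/funext => x; rewrite fimfunE fsbig_finite.
by apply: (parseval_sum mI T0 ocas (ip_cas hb)) => y; apply: (goodZ y (f := \1_(f @^-1` [set y]))); apply: good_indic; apply: (measurable_funPTI f); exact: measurable_set1.
Qed.

(** The simple approximations lie between 0 and [f] on [I], so [f ^+ 2] dominates the squared
    errors. *)
Let good_ge0 f : sqint mu I f -> (forall x, 0 <= f x) -> good f.
Proof.
move=> sf f0.
have mf : measurable_fun I (EFin \o f) by apply/measurable_EFinP; exact: sf.1.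
pose h := nnsfun_approx mI mf.
have hf (x : measurableTypeR R) : I x -> h n x @[n --> \oo] --> f x.
  move=> Ix; have /fine_cvgP[_] // : ((EFin \o (h ^~ x)) n @[n --> \oo] --> (f x)%:E).
  by apply: cvg_nnsfun_approx => // y _; rewrite lee_fin.
have nd (x : measurableTypeR R) : nondecreasing_seq (h ^~ x).
  by move=> m n mn; have /lefP := nd_nnsfun_approx mI mf mn; exact.
have hle (n : nat) (x : measurableTypeR R) : I x -> h n x <= f x.
  move=> Ix; rewrite -(cvg_lim _ (hf x Ix))//.
  by apply: nondecreasing_cvgn_le => //; apply/cvg_ex; exists (f x); exact: hf.
apply: (@parseval_dominated _ _ _ mu _ mI _ cas T T0 ocas (ip_cas hb) _ h (fun x => f x ^+ 2)) => //.
- by move=> n x Ix; rewrite lerXn2r ?nnegrE ?subr_ge0 ?hle// lerBlDr lerDl.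
- exact: sf.2.
Qed.

Lemma parseval_cas f : sqint mu I f -> good f.
Proof.
move=> [mf sf].
have mp : measurable_fun I (f^\+)%R by exact: measurable_funrpos.
have mn : measurable_fun I (f^\-)%R by exact: measurable_funrneg.
have sp : sqint mu I (f^\+)%R.
  split => //; apply: (integrable_le mI _ _ sf); first exact: measurable_funX.
  move=> x _; rewrite normrX -(real_normK (num_real (f x))) lerXn2r ?nnegrE//.
  by rewrite ger0_norm ?funrpos_ge0// /funrpos ge_max ler_norm normr_ge0.
have sn : sqint mu I (f^\-)%R.
  split => //; apply: (integrable_le mI _ _ sf); first exact: measurable_funX.
  move=> x _; rewrite normrX -(real_normK (num_real (f x))) lerXn2r ?nnegrE//.
  by rewrite ger0_norm ?funrneg_ge0// /funrneg ge_max -normrN ler_norm normr_ge0.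
rewrite (_ : f = (fun x => (f^\+)%R x - (f^\-)%R x)).
  by apply: goodB; apply: good_ge0.
by rewrite -[LHS]funrposBneg.
Qed.

End Parseval.

(** Turns sums over the integers into series, for which monotone convergence and countable a.e.
    statements are available. *)
Lemma bij_nat_int : exists e : nat -> int, set_bij [set: nat] [set: int] e.
Proof.
exists (fun n => if odd n then Negz n./2 else Posz n./2); split => //.
- move=> m n _ _; case om: (odd m); case on: (odd n) => // -[h];
  by rewrite -(odd_double_half m) -(odd_double_half n) om on h.
- move=> [n|n] _; first by exists n.*2 => //=; rewrite odd_double doubleK.
  by exists n.*2.+1 => //=; rewrite odd_double/= uphalf_double.
Qed.

(** * Sums over the integers and periodization *)

Section EsumIntegral.
Context d (X : measurableType d) (R : realType).
Variables (mu : {measure set X -> \bar R}) (D : set X).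
Hypothesis mD : measurable D.
Local Open Scope ereal_scope.

Lemma measurable_fun_esum (f : int -> X -> \bar R) :
  (forall k, measurable_fun D (f k)) -> (forall k x, 0 <= f k x) ->
  measurable_fun D (fun x => \esum_(k in [set: int]) f k x).
Proof.
move=> mf f0; have [e be] := bij_nat_int.
under eq_fun do rewrite (@reindex_esum _ _ _ _ _ e _ be) -nneseries_esumT//.
by apply: ge0_emeasurable_sum.
Qed.

Lemma integral_esum (f : int -> X -> \bar R) :
  (forall k, measurable_fun D (f k)) -> (forall k x, 0 <= f k x) ->
  \int[mu]_(x in D) (\esum_(k in [set: int]) f k x) =
  \esum_(k in [set: int]) \int[mu]_(x in D) f k x.
Proof.
move=> mf f0; have [e be] := bij_nat_int.
under eq_integral do rewrite (@reindex_esum _ _ _ _ _ e _ be) -nneseries_esumT//.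
rewrite (@reindex_esum _ _ _ _ _ e _ be) -nneseries_esumT//; last by move=> n; exact: integral_ge0.
exact: integral_nneseries.
Qed.
End EsumIntegral.

(** * Translation invariance of Lebesgue measure *)

Section Translation.
Variable R : realType.
Local Notation mu := (@lebesgue_measure R).
Local Open Scope ereal_scope.

Lemma measurable_shift (a : R) : measurable_fun [set: measurableTypeR R] (fun x : R => (x - a)%R : measurableTypeR R).
Proof. by apply: continuous_measurable_fun => x; apply: cvgB; [exact: cvg_id|exact: cvg_cst]. Qed.

(** Lebesgue measure is determined by its values on half-open intervals, and the pushforward has the
    same values there. *)
Lemma lebesgue_measure_shift (a : R) (A : set R) : measurable A ->
  pushforward mu (fun x : measurableTypeR R => (x - a)%R : measurableTypeR R) A = mu A.
Proof.
move=> mA; have ms := measurable_shift a.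
apply/esym/(@lebesgue_measure_unique _ (pushforward mu (fun x : measurableTypeR R => (x - a)%R : measurableTypeR R))) => //= _ [[x y]] _ <-.
rewrite /pushforward (_ : _ @^-1` _ = `]x + a, y + a]%classic)%R.
  by rewrite !lebesgue_measure_itv/= !lte_fin ltrD2r -!EFinB; case: ifP => // _; congr EFin; ring.
by apply/seteqP; split => z /=; rewrite !in_itv/= ltrBrDr lerBlDr.
Qed.

Lemma ge0_integral_shift (a : R) (D : set R) (f : R -> \bar R) :
  measurable D -> measurable_fun D f -> (forall x, 0 <= f x) ->
  \int[mu]_(x in [set x | D (x - a)%R]) f (x - a)%R = \int[mu]_(x in D) f x.
Proof.
move=> mD mf f0.
rewrite -(ge0_integral_pushforward (measurable_shift a) mu mD mf); last by move=> x _; exact: f0.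
apply: eq_measure_integral => [|ms A mA _]; first exact: measurable_shift.
exact: lebesgue_measure_shift.
Qed.

Lemma measurable_fun_shift (a : R) (f : R -> R) : measurable_fun setT f ->
  measurable_fun setT (fun x : measurableTypeR R => f (x - a)%R).
Proof. by move=> mf; apply: (measurableT_comp mf); exact: measurable_shift. Qed.

Lemma emeasurable_fun_shift (a : R) (f : R -> \bar R) : measurable_fun setT f ->
  measurable_fun setT (fun x : measurableTypeR R => f (x - a)%R).
Proof. by move=> mf; apply: (measurableT_comp mf); exact: measurable_shift. Qed.

End Translation.

(** * Integrals over the line as integrals over one period *)

Section Periodize.
Variables (R : realType) (b : R).
Hypothesis hb : 0 < b.
Local Notation mu := (@lebesgue_measure R).
Local Notation I := `[0, b^-1]%classic.

Let T0 : 0 < b^-1. Proof. by rewrite invr_gt0. Qed.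
Let mI : measurable (I : set (measurableTypeR R)). Proof. exact: measurable_itv. Qed.

Lemma ge0_integral_periodize (f : R -> \bar R) :
  measurable_fun setT f -> (forall x, 0 <= f x)%E ->
  (\int[mu]_x f x = \int[mu]_(x in I) \esum_(k in [set: int]) f (x - k%:~R / b)%R)%E.
Proof.
move=> mf f0; have b0 : b != 0 by rewrite gt_eqF.
rewrite integral_esum//; last first.
  by move=> k; apply: measurable_funTS; exact: emeasurable_fun_shift.
(* The tiles are half-open so as to be disjoint; the end point that [I] has in addition is null. *)
pose J (k : int) := [set x : R | 0 <= x + k%:~R / b < b^-1].
have JE k : J k = [set` `[- (k%:~R / b), - (k%:~R / b) + b^-1[].
  by apply/seteqP; split => x;
    rewrite /J /= in_itv/= -lerBlDr sub0r -ltrBrDr (addrC (- _) b^-1).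
have mJ k : measurable (J k) by rewrite JE; exact: measurable_itv.
(* A point determines its tile by a floor; this yields disjointness, and the same floor yields
   covering. *)
have Jfloor k x : J k x -> - k = Num.floor (x * b).
  move=> /andP[x0 x1]; apply/esym/floor_def.
  have e1 : x * b = (x + k%:~R / b) * b - k%:~R by field.
  have y0 : 0 <= (x + k%:~R / b) * b by rewrite mulr_ge0// ltW.
  have y1 : (x + k%:~R / b) * b < 1 by rewrite -ltr_pdivlMr// div1r.
  by apply/andP; split; rewrite ?intrD intrN; lra.
have [e [eT einj esurj]] := bij_nat_int.
have UJ : \bigcup_n J (e n) = setT.
  apply/seteqP; split => // x _.
  have [n _ en] : range e (- Num.floor (x * b)) by exact: esurj.
  exists n => //; rewrite /J /= en intrN mulNr.
  have /andP[x0 x1] := floor_itv (x * b).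
  rewrite subr_ge0 ler_pdivrMr// x0/= ltrBlDl.
  by rewrite -(ltr_pM2r hb) mulrDl divfK// mulVf//; rewrite intrD in x1.
rewrite -UJ ge0_integral_bigcup//; last 3 first.
- by move=> n; exact: mJ.
- by rewrite UJ.
- apply/trivIsetP => i j _ _ ij; apply/seteqP; split => // x [Ji Jj].
  move: ij => /eqP; apply; apply: einj; rewrite ?inE//.
  by apply: oppr_inj; rewrite (Jfloor _ _ Ji) (Jfloor _ _ Jj).
rewrite (@reindex_esum _ _ _ _ _ e _ (And3 eT einj esurj)) -nneseries_esumT//; last first.
  by move=> n; exact: integral_ge0.
apply: eq_eseriesr => n _; move: (e n) => k.
rewrite -(@ge0_integral_shift _ (k%:~R / b)%R)//; last exact: measurable_funTS.
rewrite (_ : [set x | J k (x - _)] = [set` `[0, b^-1[]); last first.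
  by apply/seteqP; split => x; rewrite /J /= in_itv/= subrK.
apply: integral_itv_bndo_bndc.
by apply: measurable_funTS; exact: emeasurable_fun_shift.
Qed.

End Periodize.

(** * Absolutely summable families of reals *)

Section RealSum.
Context {R : realType} {T : choiceType}.
Implicit Types (u v : T -> R) (F : {fset T}).

Lemma esum_fset_compl (a : T -> \bar R) F : (forall k, 0 <= a k)%E ->
  (\esum_(k in [set: T]) a k = \sum_(k <- F) a k + \esum_(k in ~` [set` F]) a k)%E.
Proof.
move=> a0; rewrite (esumID [set` F])// !setTI; congr (_ + _)%E.
by rewrite esum_fset// fsbig_finite//= set_fsetK.
Qed.

(** Phrased along finite sets ordered by inclusion, to match the filter in [wstar_sum]. *)
Lemma esum_tail (a : T -> \bar R) : (forall k, 0 <= a k)%E ->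
  (\esum_(k in [set: T]) a k < +oo)%E -> forall eps : R, 0 < eps ->
  exists F0, forall F, (F0 `<=` F)%fset -> (\esum_(k in ~` [set` F]) a k <= eps%:E)%E.
Proof.
move=> a0 aoo eps e0.
have afin : \esum_(k in [set: T]) a k \is a fin_num by rewrite ge0_fin_numE// esum_ge0.
have [_ [A [finA _] <-]] := ub_ereal_sup_adherent e0 afin.
rewrite -/(esum _ _) => lt; exists (fset_set A) => F AF.
have /= := esum_fset_compl F a0.
have le : (\sum_(k \in A) a k <= \sum_(k <- F) a k)%E.
  rewrite fsbig_finite// (big_fsetID _ (mem (fset_set A)) F)/=.
  have -> : [fset x | x in F & mem (fset_set A) x]%fset = fset_set A.
    apply/fsetP => k; rewrite !inE/=.
    by apply/andP/idP => [[]//|kA]; split => //; exact: (fsubsetP AF).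
  by rewrite leeDl//; exact: sume_ge0.
have t0 : (0 <= \esum_(k in ~` [set` F]) a k)%E by exact: esum_ge0.
have sF : (0 <= \sum_(k <- F) a k)%E by exact: sume_ge0.
move: lt le afin; set s := (\sum_(k \in A) a k)%E.
move: t0 sF; set t := esum _ _; set w := (\sum_(k <- F) a k)%E => t0 sF lt le afin E.
move: afin lt; rewrite E fin_numD => /andP[wf tf].
clearbody t w s; case: t tf t0 E => // t _ _ _; case: w wf sF le => // w _ _ le lt.
have : ((w + t - eps)%:E < w%:E)%E := lt_le_trans lt le.
by rewrite lte_fin lee_fin; lra.
Qed.

(* The sum of an absolutely summable family; a junk value otherwise. *)
Definition rsum u : R :=
  fine (\esum_(k in [set: T]) (u^\+ k)%:E) - fine (\esum_(k in [set: T]) (u^\- k)%:E).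

Lemma eq_rsum u v : u =1 v -> rsum u = rsum v.
Proof. by move=> uv; congr rsum; exact/funext. Qed.

Lemma rsum0 : rsum (fun=> 0) = 0.
Proof.
by rewrite /rsum !esum1 ?subrr// => k _; rewrite ?/funrpos ?/funrneg ?oppr0 maxxx.
Qed.

Lemma rsumN u : rsum (fun k => - u k) = - rsum u.
Proof.
rewrite /rsum opprB; congr (fine _ - fine _); apply: eq_esum => k _ //.
by rewrite /funrneg opprK.
Qed.

(** Summability is not assumed: [fine] sends infinite sums to 0, which is compatible with scaling.
    Hence [bracket_cut] and [periodize_mul] hold at every point, not just almost everywhere. *)
Lemma rsumZ c u : rsum (fun k => c * u k) = c * rsum u.
Proof.
wlog c0 : c u / 0 <= c => [H|].
  have [|/ltW c0] := leP 0 c; first exact: H.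
  apply: oppr_inj; rewrite -rsumN -mulNr -H ?oppr_ge0//.
  by apply: eq_rsum => k; rewrite mulNr.
have fineZ (x : \bar R) : fine (c%:E * x)%E = c * fine x.
  case: x => [r||]//=.
    by move: c0; rewrite le_eqVlt => /predU1P[<-|c0]; rewrite ?mul0e ?mul0r// gt0_muley// mulr0.
  by move: c0; rewrite le_eqVlt => /predU1P[<-|c0]; rewrite ?mul0e ?mul0r// gt0_muleNy// mulr0.
rewrite /rsum mulrBr -!fineZ -!esumZl//; last 2 first.
- by move=> k _; rewrite lee_fin funrneg_ge0.
- by move=> k _; rewrite lee_fin funrpos_ge0.
congr (fine _ - fine _); apply: eq_esum => k _; rewrite -EFinM; congr EFin.
  by rewrite /funrpos maxr_pMr// mulr0.
by rewrite /funrneg maxr_pMr// mulr0 mulrN.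
Qed.

(** The error is bounded by a tail of nonnegative terms, which can later be integrated term by
    term. *)
Lemma rsum_approx u F : (\esum_(k in [set: T]) `|u k|%:E < +oo)%E ->
  (`|rsum u - \sum_(k <- F) u k|%:E <= \esum_(k in ~` [set` F]) `|u k|%:E)%E.
Proof.
move=> uoo.
have p0 k : (0 <= (u^\+ k)%:E)%E by rewrite lee_fin funrpos_ge0.
have n0 k : (0 <= (u^\- k)%:E)%E by rewrite lee_fin funrneg_ge0.
have pn D : (\esum_(k in D) `|u k|%:E = \esum_(k in D) (u^\+ k)%:E + \esum_(k in D) (u^\- k)%:E)%E.
  rewrite -esumD//; apply: eq_esum => k _.
  by rewrite -EFinD; congr EFin; have /(congr1 (fun f => f k)) := funrposDneg u.
move: uoo; rewrite pn /rsum !(esum_fset_compl F)// pn.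
have : (0 <= \esum_(k in ~` [set` F]) (u^\+ k)%:E)%E by exact: esum_ge0.
have : (0 <= \esum_(k in ~` [set` F]) (u^\- k)%:E)%E by exact: esum_ge0.
rewrite !sumEFin.
case: (esum _ _) => [y| |]; case: (esum _ _) => [x| |]// y0 x0 _.
rewrite /= -EFinD lee_fin.
have -> : \sum_(k <- F) u k = \sum_(k <- F) u^\+ k - \sum_(k <- F) u^\- k.
  rewrite -sumrB; apply: eq_bigr => k _.
  by have /(congr1 (fun f => f k)) := funrposBneg u.
move: y0 x0; rewrite !lee_fin; move: (\sum_(_ <- _) _) (\sum_(_ <- _) _) => s t y0 x0.
by rewrite ler_norml; apply/andP; split; lra.
Qed.

End RealSum.

(** * Complex-valued functions and weak-* sums *)

Section ComplexModulus.
Variable R : realType.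
Implicit Types z w : R[i].

Lemma cabsE z : cabs z = Num.sqrt (complex.Re z ^+ 2 + complex.Im z ^+ 2).
Proof. by case: z. Qed.

Lemma cabs_ge0 z : 0 <= cabs z.
Proof. by rewrite cabsE sqrtr_ge0. Qed.

Lemma cabs_sqr z : cabs z ^+ 2 = complex.Re z ^+ 2 + complex.Im z ^+ 2.
Proof. by rewrite cabsE sqr_sqrtr// addr_ge0 ?sqr_ge0. Qed.

Lemma cabsM z w : cabs (z * w) = cabs z * cabs w.
Proof.
rewrite !cabsE -sqrtrM ?addr_ge0 ?sqr_ge0//; congr Num.sqrt.
by case: z w => x y [u v] /=; ring.
Qed.

Lemma cabsJ z : cabs (z^*)%C = cabs z.
Proof. by case: z => x y; rewrite !cabsE/= sqrrN. Qed.

Lemma cabsN z : cabs (- z) = cabs z.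
Proof. by case: z => x y; rewrite !cabsE/= !sqrrN. Qed.

Lemma normr_Re_le z : `|complex.Re z| <= cabs z.
Proof. by rewrite cabsE -sqrtr_sqr ler_wsqrtr// lerDl sqr_ge0. Qed.

Lemma normr_Im_le z : `|complex.Im z| <= cabs z.
Proof. by rewrite cabsE -sqrtr_sqr ler_wsqrtr// lerDr sqr_ge0. Qed.

Lemma cabs_le z : cabs z <= `|complex.Re z| + `|complex.Im z|.
Proof.
rewrite cabsE -[leRHS]ger0_norm ?addr_ge0// -sqrtr_sqr ler_wsqrtr//.
rewrite sqrrD !real_normK ?num_real// addrAC lerDl.
by rewrite mulrn_wge0// mulr_ge0.
Qed.

Lemma cabsD z w : cabs (z + w) <= cabs z + cabs w.
Proof.
rewrite -lecR /cabs; have H (u : R[i]) : (complex.Re `|u|)%:C%C = `|u| by rewrite normc_def.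
by rewrite rmorphD/= !H ler_normD.
Qed.

Lemma cabs_sum (I : Type) (s : seq I) (f : I -> R[i]) :
  cabs (\sum_(i <- s) f i) <= \sum_(i <- s) cabs (f i).
Proof.
elim: s => [|i s ih]; first by rewrite !big_nil cabsE/= expr0n addr0 sqrtr0.
by rewrite !big_cons (le_trans (cabsD _ _))// lerD2l.
Qed.

Lemma Re_sum (I : Type) (s : seq I) (f : I -> R[i]) :
  complex.Re (\sum_(i <- s) f i) = \sum_(i <- s) complex.Re (f i).
Proof. by elim: s => [|i s ih]; rewrite ?big_nil// !big_cons -ih; case: (f i) (bigop _ _ _) => ? ? [? ?]. Qed.

Lemma Im_sum (I : Type) (s : seq I) (f : I -> R[i]) :
  complex.Im (\sum_(i <- s) f i) = \sum_(i <- s) complex.Im (f i).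
Proof. by elim: s => [|i s ih]; rewrite ?big_nil// !big_cons -ih; case: (f i) (bigop _ _ _) => ? ? [? ?]. Qed.

Lemma ReM z w : complex.Re (z * w) = complex.Re z * complex.Re w - complex.Im z * complex.Im w.
Proof. by case: z w => ? ? [? ?]. Qed.
Lemma ImM z w : complex.Im (z * w) = complex.Re z * complex.Im w + complex.Im z * complex.Re w.
Proof. by case: z w => ? ? [? ?]. Qed.
Lemma ReB z w : complex.Re (z - w) = complex.Re z - complex.Re w.
Proof. by case: z w => ? ? [? ?]. Qed.
Lemma ImB z w : complex.Im (z - w) = complex.Im z - complex.Im w.
Proof. by case: z w => ? ? [? ?]. Qed.
Lemma ReJ z : complex.Re (z^*)%C = complex.Re z. Proof. by case: z. Qed.
Lemma ImJ z : complex.Im (z^*)%C = - complex.Im z. Proof. by case: z. Qed.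

End ComplexModulus.

(** * Integration of complex-valued functions *)

Section ComplexIntegral.
Variable R : realType.
Local Notation mu := (@lebesgue_measure R).
Variable D : set R.
Hypothesis mD : measurable D.
Implicit Types f h : R -> R[i].

Lemma cmeasurableM f h : cmeasurable D f -> cmeasurable D h -> cmeasurable D (fun x => f x * h x).
Proof.
move=> [fr fi] [hr hi]; split.
  rewrite (_ : _ \o _ = fun x => complex.Re (f x) * complex.Re (h x) - complex.Im (f x) * complex.Im (h x)).
    by apply: measurable_funB; exact: measurable_funM.
  by apply/funext => x /=; rewrite ReM.
rewrite (_ : _ \o _ = fun x => complex.Re (f x) * complex.Im (h x) + complex.Im (f x) * complex.Re (h x)).
  by apply: measurable_funD; exact: measurable_funM.
by apply/funext => x /=; rewrite ImM.
Qed.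

Lemma cmeasurableB f h : cmeasurable D f -> cmeasurable D h -> cmeasurable D (fun x => f x - h x).
Proof.
move=> [fr fi] [hr hi]; split.
  rewrite (_ : _ \o _ = fun x => complex.Re (f x) - complex.Re (h x)); first exact: measurable_funB.
  by apply/funext => x /=; rewrite ReB.
rewrite (_ : _ \o _ = fun x => complex.Im (f x) - complex.Im (h x)); first exact: measurable_funB.
by apply/funext => x /=; rewrite ImB.
Qed.

Lemma cmeasurableJ f : cmeasurable D f -> cmeasurable D (fun x => (f x)^*%C).
Proof.
move=> [fr fi]; split.
  by rewrite (_ : _ \o _ = fun x => complex.Re (f x))//; apply/funext => x /=; rewrite ReJ.
rewrite (_ : _ \o _ = fun x => - complex.Im (f x)); first exact: measurable_funN.
by apply/funext => x /=; rewrite ImJ.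
Qed.

Lemma cmeasurable_sum (I : Type) (s : seq I) (f : I -> R -> R[i]) :
  (forall i, cmeasurable D (f i)) -> cmeasurable D (fun x => \sum_(i <- s) f i x).
Proof.
move=> mf; split.
  rewrite (_ : _ \o _ = fun x => \sum_(i <- s) complex.Re (f i x)).
    by apply: measurable_sum => i; exact: (mf i).1.
  by apply/funext => x /=; rewrite Re_sum.
rewrite (_ : _ \o _ = fun x => \sum_(i <- s) complex.Im (f i x)).
  by apply: measurable_sum => i; exact: (mf i).2.
by apply/funext => x /=; rewrite Im_sum.
Qed.

Lemma measurable_cabs f : cmeasurable D f -> measurable_fun D (fun x => cabs (f x)).
Proof.
move=> [fr fi]; under eq_fun do rewrite cabsE.
apply: (@measurableT_comp _ _ _ _ _ _ (@Num.sqrt R)).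
  exact: continuous_measurable_fun (@sqrt_continuous R).
by apply: measurable_funD; exact: measurable_funX.
Qed.

Lemma cintegrable_cabs f : cmeasurable D f ->
  (\int[mu]_(x in D) (cabs (f x))%:E < +oo)%E -> cintegrable D f.
Proof.
move=> mf foo; split; apply/integrableP; split; do ?by apply/measurable_EFinP; case: mf.
- apply: le_lt_trans foo; apply: ge0_le_integral => //.
  + by apply/measurableT_comp => //; apply/measurable_EFinP; case: mf.
  + by apply/measurable_EFinP; exact: measurable_cabs.
  + by move=> x _; rewrite lee_fin normr_Re_le.
- apply: le_lt_trans foo; apply: ge0_le_integral => //.
  + by apply/measurableT_comp => //; apply/measurable_EFinP; case: mf.
  + by apply/measurable_EFinP; exact: measurable_cabs.
  + by move=> x _; rewrite lee_fin normr_Im_le.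
Qed.

Lemma cintegrable_measurable f : cintegrable D f -> cmeasurable D f.
Proof.
by move=> [/measurable_int/measurable_EFinP fr /measurable_int/measurable_EFinP fi].
Qed.

Lemma cintegrable_cabs_lty f : cintegrable D f ->
  (\int[mu]_(x in D) (cabs (f x))%:E < +oo)%E.
Proof.
move=> fint; have mf := cintegrable_measurable fint.
have [/integrableP[mr fr] /integrableP[mi fi]] := fint.
apply: le_lt_trans (lte_add_pinfty fr fi).
rewrite -ge0_integralD//; last 2 first.
- exact: measurableT_comp.
- exact: measurableT_comp.
apply: ge0_le_integral => //.
- by move=> x _; rewrite lee_fin cabs_ge0.
- by apply/measurable_EFinP; exact: measurable_cabs.
- by apply: emeasurable_funD; exact: measurableT_comp.
- by move=> x _; rewrite -EFinD lee_fin cabs_le.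
Qed.

(** The factor 2 comes from bounding real and imaginary parts separately; it is harmless because the
    estimate only serves to show that errors tend to 0. *)
Lemma cintegral_le f : cmeasurable D f ->
  ((cabs (cintegral D f))%:E <= 2%:E * \int[mu]_(x in D) (cabs (f x))%:E)%E.
Proof.
move=> mf; have [fy|] := ltP (\int[mu]_(x in D) (cabs (f x))%:E)%E +oo%E; last first.
  by rewrite leye_eq => /eqP ->; rewrite gt0_muley// leey.
have [ir ii] := cintegrable_cabs mf fy.
have mc : measurable_fun D (fun x => (cabs (f x))%:E).
  by apply/measurable_EFinP; exact: measurable_cabs.
have le1 (p : R -> R) : mu.-integrable D (EFin \o p) -> (forall x, `|p x| <= cabs (f x)) ->
    ((`|\int[mu]_(x in D) p x|)%:E <= \int[mu]_(x in D) (cabs (f x))%:E)%E.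
  move=> ip le; rewrite EFin_normr_Rintegral//.
  apply: (le_trans (le_abse_integral mu mD _)); first exact: measurable_int ip.
  apply: ge0_le_integral => //.
  - by apply: measurableT_comp => //; exact: measurable_int ip.
  - by move=> x _; rewrite lee_fin le.
apply: (@le_trans _ _ ((`|complex.Re (cintegral D f)| + `|complex.Im (cintegral D f)|)%:E)).
  by rewrite lee_fin cabs_le.
rewrite (_ : 2%:E = 1%:E + 1%:E)%E; last by rewrite -EFinD.
rewrite ge0_muleDl// mul1e EFinD; apply: leeD.
  by apply: le1 => // x; exact: normr_Re_le.
by apply: le1 => // x; exact: normr_Im_le.
Qed.

Lemma cintegralB f h : cintegrable D f -> cintegrable D h ->
  cintegral D f - cintegral D h = cintegral D (fun x => f x - h x).
Proof.
move=> [fr fi] [hr hi]; rewrite /cintegral; apply/eqP; rewrite eq_complex/=; apply/andP; split; apply/eqP.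
  by rewrite -RintegralB//; apply: eq_Rintegral => x _ /=; rewrite ReB.
by rewrite -RintegralB//; apply: eq_Rintegral => x _ /=; rewrite ImB.
Qed.

Lemma cintegrableM_bounded f h (M : R) : cmeasurable D f ->
  {ae mu, forall x, D x -> cabs (f x) <= M} -> cintegrable D h -> cintegrable D (fun x => f x * h x).
Proof.
move=> mf fM ih; have mh := cintegrable_measurable ih.
apply: cintegrable_cabs; first exact: cmeasurableM.
have := cintegrable_cabs_lty ih => hoo.
apply: (@le_lt_trans _ _ (\int[mu]_(x in D) (`|M|%:E * (cabs (h x))%:E))%E).
  apply: ae_ge0_le_integral => //.
  - by move=> x _; rewrite lee_fin cabs_ge0.
  - by apply/measurable_EFinP; exact: (measurable_cabs (cmeasurableM mf mh)).
  - by move=> x _; rewrite -EFinM lee_fin mulr_ge0// cabs_ge0.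
  - by apply: measurable_funeM; apply/measurable_EFinP; exact: (measurable_cabs mh).
  - near=> x => Dx; rewrite -EFinM lee_fin cabsM ler_wpM2r ?cabs_ge0//.
    by rewrite (le_trans _ (ler_norm _))// (near fM x).
rewrite ge0_integralZl//.
- by rewrite lte_mul_pinfty.
- by apply/measurable_EFinP; exact: (measurable_cabs mh).
- by move=> x _; rewrite lee_fin cabs_ge0.
Unshelve. all: by end_near. Qed.

End ComplexIntegral.

#[local] Instance lebesgue_ae_filter (R : realType) :
  Filter (nbhs (almost_everywhere (@lebesgue_measure R))).
Proof. exact: (ae_filter_ringOfSetsType (@lebesgue_measure R)). Qed.

#[local] Existing Instance summability.totally_filter.

Lemma ae_forall_int (R : realType) (P : int -> R -> Prop) :
  (forall k, {ae (@lebesgue_measure R), forall x, P k x}) ->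
  {ae (@lebesgue_measure R), forall x, forall k, P k x}.
Proof.
move=> aeP; have [e [_ _ esurj]] := bij_nat_int.
have aeQ := ae_foralln (fun n => aeP (e n)).
near=> x => k; have [n _ <-] : range e k by exact: esurj.
exact: (near aeQ x).
Unshelve. all: by end_near. Qed.

(** * Weak-* sums over a period *)

Section WeakStarSum.
Variables (R : realType) (b : R).
Hypothesis hb : 0 < b.
Local Notation mu := (@lebesgue_measure R).
Local Notation I := `[0, b^-1]%classic.
Implicit Types (u : int -> R -> R[i]) (h S : R -> R[i]).

Let mI : measurable (I : set (measurableTypeR R)). Proof. exact: measurable_itv. Qed.
Let muIE : mu I = (b^-1)%:E.
Proof. by rewrite lebesgue_measure_itv/= lte_fin invr_gt0 hb -EFinD subr0. Qed.

Lemma ae_mrestr (P : R -> Prop) :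
  {ae mrestr mu (measurable_itv `[0, b^-1]), forall x, P x} <-> {ae mu, forall x, I x -> P x}.
Proof.
split=> -[N [mN N0 sN]].
  exists (N `&` I); split => //; first exact: measurableI.
  by move=> x /= /not_implyP[Ix nP]; split => //; exact: sN.
exists (N `|` ~` I); split => //.
- by apply: measurableU => //; exact: measurableC.
- rewrite /mrestr setIUl setICl setU0; apply/eqP; rewrite eq_le measure_ge0 andbT.
  by rewrite -N0; apply: le_measure; rewrite ?inE//; exact: measurableI.
- move=> x /= nP; have [Ix|] := pselect (I x); last by right.
  by left; apply: sN => /(_ Ix).
Qed.

Lemma esssup_periodP (F : R -> \bar R) :
  (esssup_period b F < +oo)%E <->
  exists M : R, {ae mu, forall x, I x -> (F x <= M%:E)%E}.
Proof.
split=> [|[M FM]]; last first.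
  apply: (@le_lt_trans _ _ M%:E); last exact: ltry.
  by apply/ess_supP; exact/ae_mrestr.
rewrite /esssup_period; set s := ess_sup _ _ => soo.
have Fs : {ae mu, forall x, I x -> (F x <= s)%E} by apply/ae_mrestr/ess_supP.
case: s soo Fs => [r| |] // _ Fs; first by exists r.
(* If the essential supremum is -oo, any real bound will do. *)
by exists 0; near=> x => Ix; apply: (@le_trans _ _ -oo%E); [exact: (near Fs x)|exact: leNye].
Unshelve. all: by end_near. Qed.

Lemma LinfP h : Linf b h <-> cmeasurable I h /\ exists M : R, {ae mu, forall x, I x -> cabs (h x) <= M}.
Proof.
split=> -[mh].
  move=> /esssup_periodP[M hM]; split => //; exists M.
  by near=> x => Ix; rewrite -lee_fin; exact: (near hM x).
move=> [M hM]; split => //; apply/esssup_periodP; exists M.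
by near=> x => Ix; rewrite lee_fin; exact: (near hM x).
Unshelve. all: by end_near. Qed.

Definition csum (z : int -> R[i]) : R[i] :=
  (rsum (fun k => complex.Re (z k)) +i* rsum (fun k => complex.Im (z k)))%C.

Lemma csum_approx (z : int -> R[i]) (F : {fset int}) :
  (\esum_(k in [set: int]) (cabs (z k))%:E < +oo)%E ->
  ((cabs (csum z - \sum_(k <- F) z k))%:E <= 2%:E * \esum_(k in ~` [set` F]) (cabs (z k))%:E)%E.
Proof.
move=> zoo.
have bound (p : int -> R) : (forall k, `|p k| <= cabs (z k)) ->
    (`|rsum p - \sum_(k <- F) p k|%:E <= \esum_(k in ~` [set` F]) (cabs (z k))%:E)%E.
  move=> pz; apply: le_trans (rsum_approx F _) _.
    by apply: le_lt_trans zoo; apply: le_esum => k _; rewrite lee_fin.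
  by apply: le_esum => k _; rewrite lee_fin.
apply: (@le_trans _ _ (`|complex.Re (csum z - \sum_(k <- F) z k)| +
    `|complex.Im (csum z - \sum_(k <- F) z k)|)%:E); first by rewrite lee_fin cabs_le.
rewrite ReB ImB Re_sum Im_sum EFinD (_ : 2%:E = 1%:E + 1%:E)%E; last by rewrite -EFinD.
rewrite ge0_muleDl// mul1e; apply: leeD; apply: bound => k.
  exact: normr_Re_le.
exact: normr_Im_le.
Qed.

Lemma csum_le (z : int -> R[i]) : (\esum_(k in [set: int]) (cabs (z k))%:E < +oo)%E ->
  ((cabs (csum z))%:E <= 2%:E * \esum_(k in [set: int]) (cabs (z k))%:E)%E.
Proof.
move=> zoo; have := csum_approx fset0 zoo.
by rewrite big_seq_fset0 subr0 (_ : ~` _ = setT)//; apply/seteqP; split.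
Qed.

Lemma measurable_rsum (D : set R) (p : int -> R -> R) : measurable D ->
  (forall k, measurable_fun D (p k)) -> measurable_fun D (fun x => rsum (p ^~ x)).
Proof.
move=> mD mp; apply: measurable_funB.
  apply: measurableT_comp => //; apply: measurable_fun_esum => // [k|k x].
    by apply/measurable_EFinP; apply: (measurable_funrpos (f := p k)).
  by rewrite lee_fin funrpos_ge0.
apply: measurableT_comp => //; apply: measurable_fun_esum => // [k|k x].
  by apply/measurable_EFinP; apply: (measurable_funrneg (f := p k)).
by rewrite lee_fin funrneg_ge0.
Qed.

Lemma cmeasurable_csum (D : set R) u : measurable D ->
  (forall k, cmeasurable D (u k)) -> cmeasurable D (fun x => csum (u ^~ x)).
Proof.
move=> mD mu_; split; apply: measurable_rsum => // k; by case: (mu_ k).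
Qed.

(** Against [phi] in [L1], the integrals of [|u k| |phi|] have a finite sum, at most [|M|] times the
    [L1] norm of [phi]. The error of a finite partial sum is controlled by the tail of that sum. *)
Lemma wstar_sum_csum u h (M : R) :
  (forall k, cmeasurable I (u k)) -> cmeasurable I h ->
  {ae mu, forall x, I x -> (\esum_(k in [set: int]) (cabs (u k x))%:E <= M%:E)%E} ->
  {ae mu, forall x, I x -> h x = csum (u ^~ x)} ->
  wstar_sum b u h.
Proof.
move=> mu_ mh uM hu.
have uk k : {ae mu, forall x, I x -> cabs (u k x) <= M}.
  near=> x => Ix; rewrite -lee_fin; apply: le_trans (near uM x _ Ix) => //.
  have := @sum_le_esum _ _ [set: int] (fun k => (cabs (u k x))%:E) [fset k]%fset (@subsetT _ _).
  by rewrite big_seq_fset1.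
have hM : {ae mu, forall x, I x -> cabs (h x) <= 2 * M}.
  near=> x => Ix; rewrite (near hu x)// -lee_fin.
  have Mx : (\esum_(k in [set: int]) (cabs (u k x))%:E <= M%:E)%E by exact: (near uM x).
  apply: le_trans (csum_le _) _; first by rewrite (le_lt_trans Mx)// ltry.
  by rewrite EFinM lee_pmul2l.
split.
- by move=> k; apply/LinfP; split => //; exists M; exact: uk.
- by apply/LinfP; split => //; exists (2 * M).
move=> phi iphi; have mphi := cintegrable_measurable iphi.
pose a k : \bar R := (\int[mu]_(x in I) (cabs (u k x) * cabs (phi x))%:E)%E.
have mcu k : measurable_fun I (fun x => cabs (u k x)) by exact: measurable_cabs.
have mcp : measurable_fun I (fun x => cabs (phi x)) by exact: measurable_cabs.
have ma k : measurable_fun I (fun x => (cabs (u k x) * cabs (phi x))%:E).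
  by apply/measurable_EFinP; exact: measurable_funM.
have a0 k : (0 <= a k)%E.
  by apply: integral_ge0 => x _; rewrite lee_fin mulr_ge0// cabs_ge0.
have aoo : (\esum_(k in [set: int]) a k < +oo)%E.
  rewrite /a -integral_esum//; last by move=> k x; rewrite lee_fin mulr_ge0// cabs_ge0.
  apply: (@le_lt_trans _ _ (\int[mu]_(x in I) (`|M|%:E * (cabs (phi x))%:E))%E).
    apply: ae_ge0_le_integral => //.
    - by move=> x _; apply: esum_ge0 => k _; rewrite lee_fin mulr_ge0// cabs_ge0.
    - by apply: measurable_fun_esum => // k x; rewrite lee_fin mulr_ge0// cabs_ge0.
    - by move=> x _; rewrite -EFinM lee_fin mulr_ge0// cabs_ge0.
    - by apply: measurable_funeM; exact/measurable_EFinP.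
    near=> x => Ix; under eq_esum do rewrite mulrC EFinM.
    rewrite esumZl ?cabs_ge0//; last by move=> k _; rewrite lee_fin cabs_ge0.
    rewrite muleC lee_wpmul2r ?lee_fin ?cabs_ge0//.
    apply: le_trans (near uM x _ Ix) _ => //.
    by rewrite lee_fin ler_norm.
  rewrite ge0_integralZl//; last 2 first.
  - exact/measurable_EFinP.
  - by move=> x _; rewrite lee_fin cabs_ge0.
  by rewrite lte_mul_pinfty// (cintegrable_cabs_lty mI iphi).
(* The constant 4 is the 2 of [cintegral_le] times the 2 of [csum_approx]. *)
have key (F : {fset int}) :
    ((cabs (cintegral I (fun x => (\sum_(k <- F) u k x) * phi x)
       - cintegral I (fun x => h x * phi x)))%:E <= 4%:E * \esum_(k in ~` [set` F]) a k)%E.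
  have mS : cmeasurable I (fun x => \sum_(k <- F) u k x) by exact: cmeasurable_sum.
  have iS : cintegrable I (fun x => (\sum_(k <- F) u k x) * phi x).
    apply: (@cintegrableM_bounded _ _ mI _ _ M) => //.
    near=> x => Ix; rewrite -lee_fin; apply: le_trans (near uM x _ Ix) => //.
    apply: le_trans (@sum_le_esum _ _ [set: int] _ F (@subsetT _ _)).
    by rewrite sumEFin lee_fin cabs_sum.
  have ih : cintegrable I (fun x => h x * phi x).
    exact: (@cintegrableM_bounded _ _ mI _ _ (2 * M)).
  rewrite cintegralB//; apply: le_trans (cintegral_le mI _) _.
    by apply: cmeasurableB; exact: cmeasurableM.
  rewrite (_ : 4 = 2 * 2 :> R); last by ring.
  rewrite EFinM -muleA lee_pmul2l//.
  (* The tail is written as a sum over all integers with zero terms on [F], so that [integral_esum]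
     can exchange it with the integral. *)
  rewrite esum_mkcond.
  have E k : (if k \in ~` [set` F] then a k else 0%E) =
      (\int[mu]_(x in I) (if k \in ~` [set` F] then (cabs (u k x) * cabs (phi x))%:E else 0))%E.
    by case: ifP => // _; rewrite integral0.
  under eq_esum do rewrite E.
  have mif k : measurable_fun I
      (fun x => if k \in ~` [set` F] then (cabs (u k x) * cabs (phi x))%:E else 0%E).
    by case: (k \in _); [exact: ma|exact: measurable_cst].
  rewrite -integral_esum//; last 1 first.
  - by move=> k x; case: ifP => // _; rewrite lee_fin mulr_ge0// cabs_ge0.
  rewrite -ge0_integralZl//; last 2 first.
  - apply: measurable_fun_esum => // k x.
    by case: ifP => // _; rewrite lee_fin mulr_ge0// cabs_ge0.
  - by move=> x _; apply: esum_ge0 => k _; case: ifP => // _; rewrite lee_fin mulr_ge0// cabs_ge0.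
  apply: ae_ge0_le_integral => //.
  - by move=> x _; rewrite lee_fin cabs_ge0.
  - apply/measurable_EFinP.
    exact: (measurable_cabs (cmeasurableB (cmeasurableM mS mphi) (cmeasurableM mh mphi))).
  - move=> x _; rewrite mule_ge0//.
    by apply: esum_ge0 => k _; case: ifP => // _; rewrite lee_fin mulr_ge0// cabs_ge0.
  - apply: measurable_funeM; apply: measurable_fun_esum => // k x.
    by case: ifP => // _; rewrite lee_fin mulr_ge0// cabs_ge0.
  near=> x => Ix.
  rewrite -mulrBl cabsM (near hu x)// -cabsN opprB -esum_mkcond.
  under eq_esum do rewrite mulrC EFinM.
  rewrite esumZl ?cabs_ge0//; last by move=> k _; rewrite lee_fin cabs_ge0.
  rewrite muleCA EFinM muleC lee_wpmul2l ?lee_fin ?cabs_ge0//.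
  apply: csum_approx.
  by rewrite (le_lt_trans (near uM x _ Ix))// ltry.
apply/cvgr0Pnorm_le => eps eps0.
have [F0 F0P] := esum_tail a0 aoo (divr_gt0 eps0 (ltr0Sn R 3)).
exists F0 => //= F F0F; rewrite ger0_norm ?cabs_ge0// -lee_fin.
apply: le_trans (key F) _.
apply: le_trans (lee_wpmul2l _ (F0P F F0F)) _ => //.
by rewrite -EFinM lee_fin mulrC divfK.
Unshelve. all: by end_near. Qed.

(** Test with [phi] the conjugate of [h - h'], which is bounded, hence integrable on [I]: the two
    limits of the same sums agree, so the integral of [|h - h'|^2] is 0. *)
Lemma wstar_sum_unique u h h' : wstar_sum b u h -> wstar_sum b u h' ->
  {ae mu, forall x, I x -> h x = h' x}.
Proof.
move=> [_ /LinfP[mh [M hM]] Hh] [_ /LinfP[mh' [M' hM']] Hh'].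
pose phi x := ((h x - h' x)^*)%C.
have mphi : cmeasurable I phi by apply: cmeasurableJ; exact: cmeasurableB.
have i1 : cintegrable I (fun=> 1 : R[i]).
  by split; apply: continuous_itv_integrable => x; exact: cvg_cst.
have phiM : {ae mu, forall x, I x -> cabs (phi x) <= M + M'}.
  near=> x => Ix; rewrite cabsJ (le_trans (cabsD _ _))// cabsN lerD//.
    exact: (near hM x).
  exact: (near hM' x).
have iphi : cintegrable I phi.
  have := cintegrableM_bounded mI mphi phiM i1.
  by rewrite (_ : (fun x => phi x * 1) = phi)//; apply/funext => x; rewrite mulr1.
have ih : cintegrable I (fun x => h x * phi x) by exact: (cintegrableM_bounded mI mh hM).
have ih' : cintegrable I (fun x => h' x * phi x) by exact: (cintegrableM_bounded mI mh' hM').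
have E : cabs (cintegral I (fun x => h x * phi x) - cintegral I (fun x => h' x * phi x)) = 0.
  apply/eqP; rewrite eq_le cabs_ge0 andbT; apply/ler_addgt0Pr => eps eps0; rewrite add0r.
  have e2 : 0 < eps / 2 by rewrite divr_gt0.
  have /cvgr0Pnorm_le/(_ _ e2)[F _ HF] := Hh _ iphi.
  have /cvgr0Pnorm_le/(_ _ e2)[F' _ HF'] := Hh' _ iphi.
  (* The union of the two finite sets gives one partial sum close to both limits. *)
  have := HF (F `|` F')%fset (fsubsetUl F F').
  have := HF' (F `|` F')%fset (fsubsetUr F F').
  rewrite /= !ger0_norm ?cabs_ge0// => le1 le2.
  move: le1 le2; set s := cintegral _ (fun x => _ * phi x) => le1 le2.
  rewrite (_ : _ - _ = (s - cintegral I (fun x => h' x * phi x)) - (s - cintegral I (fun x => h x * phi x))).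
    rewrite (le_trans (cabsD _ _))// cabsN; lra.
  by rewrite opprB [RHS]addrC addrA subrK.
have iN : cintegrable I (fun x => h x * phi x - h' x * phi x).
  have := cintegrableM_bounded mI (cmeasurableB mh mh') _ iphi.
  move=> /(_ (M + M')) H; have -> : (fun x => h x * phi x - h' x * phi x) = (fun x => (h x - h' x) * phi x).
    by apply/funext => x; rewrite mulrBl.
  by apply: H; near=> x => Ix; have := near phiM x _ Ix; rewrite cabsJ; exact.
have E2 : \int[mu]_(x in I) (cabs (h x - h' x) ^+ 2) = 0.
  apply/eqP; rewrite -normr_le0 -[leRHS]E cintegralB//.
  apply: le_trans (normr_Re_le _); rewrite /cintegral/= le_eqVlt; apply/orP; left; apply/eqP.
  congr (`|_|); apply: eq_Rintegral => x _; rewrite /= -mulrBl cabs_sqr /phi.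
  by rewrite ReM ReJ ImJ; ring.
have i2 : mu.-integrable I (EFin \o (fun x => cabs (h x - h' x) ^+ 2)).
  apply: eq_integrable iN.1 => // x _; rewrite /= -mulrBl cabs_sqr /phi.
  by rewrite ReM ReJ ImJ; congr EFin; ring.
have m2 := measurable_int _ i2.
have : ae_eq mu I (fun x => (cabs (h x - h' x) ^+ 2)%:E) (cst 0%E).
  apply/(ae_eq_integral_abs mu mI m2).
  under eq_integral do rewrite gee0_abs ?lee_fin ?sqr_ge0//.
  by rewrite -(EFin_Rintegral mI i2) E2.
move=> ae0; near=> x => Ix.
have /eqP : (cabs (h x - h' x) ^+ 2)%:E = 0%E by exact: (near ae0 x _ Ix).
rewrite eqe sqrf_eq0 => /eqP c0; apply/eqP; rewrite -subr_eq0; move: c0.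
case: (h x - h' x) => p q; rewrite cabsE/= => /eqP; rewrite sqrtr_eq0 => pq.
have p2 : p ^+ 2 <= 0 by apply: le_trans pq; rewrite lerDl sqr_ge0.
have q2 : q ^+ 2 <= 0 by apply: le_trans pq; rewrite lerDr sqr_ge0.
have : p == 0 by rewrite -sqrf_eq0 eq_le p2 sqr_ge0.
have : q == 0 by rewrite -sqrf_eq0 eq_le q2 sqr_ge0.
by move=> /eqP -> /eqP ->.
Unshelve. all: by end_near. Qed.

(** Exhibiting one weak-* limit [h] shows that the choice made in [mod_ip] is not its default value,
    and uniqueness identifies it with [h]. *)
Lemma mod_ip_wstar (f g : R -> R[i]) h :
  wstar_sum b (fun k x => f (x - k%:~R / b) * (g (x - k%:~R / b))^*%C) h ->
  cmeasurable I (mod_ip b f g) /\ {ae mu, forall x, I x -> mod_ip b f g x = h x}.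
Proof.
move=> wh; have w : wstar_sum b (fun k x => f (x - k%:~R / b) * (g (x - k%:~R / b))^*%C) (mod_ip b f g).
  exact: (@xgetPex _ (cst 0) [set h | wstar_sum b _ h] (ex_intro _ h wh)).
split; last exact: wstar_sum_unique w wh.
by case: w => _ [].
Qed.

(** For nonnegative terms the limit along finite sets is the supremum of the partial sums, since any
    [F] can be enlarged to [F] together with [F0]. *)
Lemma esum_totally (c : int -> R) (s : R) : (forall k, 0 <= c k) ->
  (forall eps, 0 < eps -> exists F0 : {fset int}, forall F, (F0 `<=` F)%fset ->
     `|\sum_(k <- F) c k - s| <= eps) ->
  (\esum_(k in [set: int]) (c k)%:E = s%:E)%E.
Proof.
move=> c0 H; apply/eqP; rewrite eq_le; apply/andP; split.
  apply: esum_le_fset => F _; rewrite sumEFin lee_fin; apply/ler_addgt0Pr => eps eps0.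
  have [F0 /(_ (F `|` F0)%fset (fsubsetUr _ _))] := H _ eps0.
  rewrite ler_distl => /andP[_]; apply: le_trans.
  rewrite [leRHS](big_fsetID _ (mem F))/=.
  rewrite (_ : [fset x | x in (F `|` F0)%fset & x \in mem F]%fset = F); last first.
    by apply/fsetP => k; rewrite !inE/=; case: (k \in F); rewrite ?andbF.
  by rewrite lerDl; apply: sumr_ge0.
apply/lee_addgt0Pr => eps eps0.
have [F0 /(_ F0 (fsubset_refl _))] := H _ eps0.
rewrite distrC ler_distl => /andP[_ le].
apply: (@le_trans _ _ (\sum_(k <- F0) c k + eps)%:E); first by rewrite lee_fin.
by rewrite EFinD leeD2r// -sumEFin; exact: sum_le_esum.
Qed.

(** Weak-* convergence tested against the constant 1, which is integrable on [I]; no pointwise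
    relation between [u] and [S] is needed. *)
Lemma wstar_sum_integral u S (c : int -> R -> R) : wstar_sum b u S ->
  (forall k, mu.-integrable I (EFin \o c k)) -> (forall k x, 0 <= c k x) ->
  (forall k, {ae mu, forall x, I x -> u k x = (c k x)%:C%C}) ->
  (\esum_(k in [set: int]) \int[mu]_(x in I) (c k x)%:E =
   (\int[mu]_(x in I) complex.Re (S x))%:E)%E.
Proof.
move=> [uL SL uS] ic c0 uc.
have i1 : cintegrable I (fun=> 1 : R[i]).
  by split; apply: continuous_itv_integrable => x; exact: cvg_cst.
under eq_esum do rewrite -(EFin_Rintegral mI (ic _)).
apply: esum_totally => [k|eps eps0]; first exact: Rintegral_ge0.
have /cvgr0Pnorm_le/(_ _ eps0)[F0 _ HF] := uS _ i1.
exists F0 => F F0F; have := HF F F0F; rewrite /= ger0_norm ?cabs_ge0//.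
apply: le_trans; apply: le_trans (normr_Re_le _); rewrite ReB /cintegral/=.
rewrite le_eqVlt; apply/orP; left; apply/eqP; congr (`|_ - _|); last first.
  by apply: eq_Rintegral => x _ /=; rewrite mulr1.
rewrite -Rintegral_sum//; congr fine; apply: ae_eq_integral => //.
- by have := integrable_sumr mI F ic => /measurable_int.
- apply/measurable_EFinP.
  have : cmeasurable I (fun x => \sum_(k <- F) u k x).
    by apply: cmeasurable_sum => k; case: (uL k).
  case=> + _; congr (measurable_fun _ _).
  by apply/funext => x /=; rewrite mulr1.
have aeF := ae_forall_int uc.
by near=> x => Ix /=; rewrite mulr1 Re_sum; congr EFin; apply: eq_bigr => k _; rewrite (near aeF x).
Unshelve. all: by end_near. Qed.

End WeakStarSum.

(** * The pointwise bracket *)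

Section Brackets.
Variables (R : realType) (b : R).
Hypothesis hb : 0 < b.
Local Notation mu := (@lebesgue_measure R).
Local Notation T := (b^-1).
Local Notation I := `[0, b^-1]%classic.
Implicit Types (f g h : R -> R[i]) (E : set R).

Let T0 : 0 < T. Proof. by rewrite invr_gt0. Qed.
Let mI : measurable (I : set (measurableTypeR R)). Proof. exact: measurable_itv. Qed.
Let muIE : mu I = T%:E.
Proof. by rewrite lebesgue_measure_itv/= lte_fin T0 -EFinD subr0. Qed.

Definition sqsum f (x : R) : \bar R :=
  \esum_(k in [set: int]) ((cabs (f (x - k%:~R / b))) ^+ 2)%:E.

(* On [Linfl2] an explicit representative of [mod_ip b f g]; unlike the latter it is
   usable for [f] merely in [L2]. *)
Definition bracket f g (x : R) : R[i] :=
  csum (fun k => f (x - k%:~R / b) * (g (x - k%:~R / b))^*%C).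

Lemma bij_addz (n : int) : set_bij [set: int] [set: int] (fun k => n + k).
Proof.
split; [by []|by move=> k l _ _; exact: addrI|].
by move=> k _; exists (k - n) => //; rewrite addrC subrK.
Qed.

Lemma shift_shift (x : R) (n k : int) : x - n%:~R / b - k%:~R / b = x - (n + k)%:~R / b.
Proof. by rewrite intrD mulrDl opprD addrA. Qed.

Lemma sqsum_periodic f x n : sqsum f (x - n%:~R / b) = sqsum f x.
Proof.
rewrite /sqsum [RHS](@reindex_esum _ _ _ _ _ (fun k => n + k) _ (bij_addz n)).
by apply: eq_esum => k _; rewrite shift_shift.
Qed.

Lemma rsum_addz (p : int -> R) n : rsum (fun k => p (n + k)) = rsum p.
Proof.
rewrite /rsum [in RHS](@reindex_esum _ _ _ _ _ (fun k => n + k) _ (bij_addz n)).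
by rewrite [X in _ = _ - fine X](@reindex_esum _ _ _ _ _ (fun k => n + k) _ (bij_addz n)).
Qed.

Lemma bracket_periodic f g x n : bracket f g (x - n%:~R / b) = bracket f g x.
Proof.
rewrite /bracket /csum; congr (_ +i* _)%C.
  rewrite -[RHS](rsum_addz _ n); apply: eq_rsum => k; by rewrite shift_shift.
rewrite -[RHS](rsum_addz _ n); apply: eq_rsum => k; by rewrite shift_shift.
Qed.

Lemma sqsum_ge0 f x : (0 <= sqsum f x)%E.
Proof. by apply: esum_ge0 => k _; rewrite lee_fin sqr_ge0. Qed.

Lemma cmeasurable_shift f (a : R) : cmeasurable setT f -> cmeasurable setT (fun x => f (x - a)).
Proof.
by move=> [fr fi]; split; [exact: (measurable_fun_shift a fr)|exact: (measurable_fun_shift a fi)].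
Qed.

Lemma measurable_sqsum f : cmeasurable setT f -> measurable_fun setT (sqsum f).
Proof.
move=> mf; apply: measurable_fun_esum => // [k|k x]; last by rewrite lee_fin sqr_ge0.
apply/measurable_EFinP; apply: measurable_funX; apply: measurable_cabs.
exact: cmeasurable_shift.
Qed.

Lemma cmeasurable_bracket f g : cmeasurable setT f -> cmeasurable setT g ->
  cmeasurable setT (bracket f g).
Proof.
move=> mf mg; apply: (@cmeasurable_csum _ setT (fun k x => f (x - k%:~R / b) * (g (x - k%:~R / b))^*%C)) => // k.
by apply: cmeasurableM; [exact: cmeasurable_shift|apply: cmeasurableJ; exact: cmeasurable_shift].
Qed.

Lemma measurable_cabs2 f : cmeasurable setT f -> measurable_fun setT (fun x => ((cabs (f x)) ^+ 2)%:E).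
Proof. by move=> mf; apply/measurable_EFinP; apply: measurable_funX; exact: measurable_cabs. Qed.

Lemma L2normsq_sqsum f : cmeasurable setT f -> L2normsq f = (\int[mu]_(x in I) sqsum f x)%E.
Proof.
move=> mf; rewrite /L2normsq (ge0_integral_periodize hb (f := fun x => ((cabs (f x)) ^+ 2)%:E))//.
  exact: measurable_cabs2.
by move=> x; rewrite lee_fin sqr_ge0.
Qed.

Lemma Linfl2P f : Linfl2 b f <-> cmeasurable setT f /\
  exists M : R, {ae mu, forall x, I x -> (sqsum f x <= M%:E)%E}.
Proof.
split=> -[mf].
  by move=> /esssup_periodP[M fM]; split => //; exists M.
by move=> [M fM]; split => //; apply/esssup_periodP; exists M.
Qed.

Lemma Linfl2_L2 f : Linfl2 b f -> L2 f.
Proof.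
move=> /Linfl2P[mf [M fM]]; split => //; rewrite L2normsq_sqsum//.
apply: (@le_lt_trans _ _ (\int[mu]_(x in I) (cst `|M|%:E x))%E).
  apply: ae_ge0_le_integral => //.
  - by move=> x _; exact: sqsum_ge0.
  - by apply: measurable_funTS; exact: measurable_sqsum.
  - by move=> x _; rewrite /cst lee_fin.
  near=> x => Ix; apply: le_trans (near fM x _ Ix) _ => //.
  by rewrite /cst lee_fin ler_norm.
by rewrite integral_cst// [X in (_ * X)%E]muIE -EFinM ltry.
Unshelve. all: by end_near. Qed.

Lemma sqsum_lty f : L2 f -> {ae mu, forall x, I x -> (sqsum f x < +oo)%E}.
Proof.
move=> [mf foo]; rewrite L2normsq_sqsum// in foo.
have mF : measurable_fun I (sqsum f) by apply: measurable_funTS; exact: measurable_sqsum.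
have iF : mu.-integrable I (sqsum f).
  apply/integrableP; split => //; apply: le_lt_trans foo.
  by under eq_integral do rewrite gee0_abs ?sqsum_ge0//.
have := integrable_ae mI iF => H; near=> x => Ix.
by rewrite -ge0_fin_numE ?sqsum_ge0//; exact: (near H x _ Ix).
Unshelve. all: by end_near. Qed.

(** A weighted arithmetic-geometric mean inequality term by term; the weight [t] is left free so
    that it can be chosen depending on [x]. *)
Lemma abs_sum_le f g x (t : R) : 0 < t ->
  (\esum_(k in [set: int]) (cabs (f (x - k%:~R / b) * (g (x - k%:~R / b))^*%C))%:E <=
   t%:E * sqsum f x + (t^-1)%:E * sqsum g x)%E.
Proof.
move=> t0; rewrite /sqsum -!esumZl ?invr_ge0 ?(ltW t0)//; do ?by move=> k _; rewrite lee_fin sqr_ge0.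
rewrite -esumD; do ?by move=> k _; rewrite mule_ge0 ?lee_fin ?sqr_ge0 ?invr_ge0 ?(ltW t0).
apply: le_esum => k _; rewrite -!EFinM -EFinD lee_fin cabsM cabsJ.
move: (cabs (f _)) (cabs (g _)) (cabs_ge0 (f (x - k%:~R / b))) (cabs_ge0 (g (x - k%:~R / b))) => u v u0 v0.
have -> : t * u ^+ 2 + t^-1 * v ^+ 2 = t * (u - t^-1 * v) ^+ 2 + 2 * (u * v).
  by field; rewrite gt_eqF.
have : 0 <= t * (u - t^-1 * v) ^+ 2 by rewrite mulr_ge0 ?sqr_ge0// ltW.
have : 0 <= u * v by rewrite mulr_ge0.
by lra.
Qed.

(* [abs_sum_le] at [t = (F + 1)^(-1/2)]: growth in [sqrt F] makes brackets of [L2]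
   functions square integrable. *)
Lemma abs_sum_sqrt_le f g x (F G : R) : 0 <= F ->
  (sqsum f x <= F%:E)%E -> (sqsum g x <= G%:E)%E ->
  (\esum_(k in [set: int]) (cabs (f (x - k%:~R / b) * (g (x - k%:~R / b))^*%C))%:E <=
   ((1 + G) * Num.sqrt (F + 1))%:E)%E.
Proof.
move=> F0 fF gG; have F1 : 0 < F + 1 by rewrite ltr_wpDl.
have s0 : 0 < Num.sqrt (F + 1) by rewrite sqrtr_gt0.
have G0 : 0 <= G by rewrite -lee_fin (le_trans (sqsum_ge0 g x)).
apply: le_trans (@abs_sum_le _ _ _ (Num.sqrt (F + 1))^-1 _) _; first by rewrite invr_gt0.
rewrite invrK mulrDl mul1r EFinD; apply: leeD; last first.
  by rewrite [(G * _)%R]mulrC EFinM lee_pmul2l.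
apply: (@le_trans _ _ ((Num.sqrt (F + 1))^-1%:E * F%:E)%E).
  by rewrite lee_pmul2l// lte_fin invr_gt0.
rewrite -EFinM lee_fin ler_pdivrMl// -expr2 sqr_sqrtr ?lerDl//; exact: ltW.
Qed.

Lemma cabs_bracket_le f g x (F G : R) : 0 <= F ->
  (sqsum f x <= F%:E)%E -> (sqsum g x <= G%:E)%E ->
  cabs (bracket f g x) <= 2 * ((1 + G) * Num.sqrt (F + 1)).
Proof.
move=> F0 fF gG; have H := abs_sum_sqrt_le F0 fF gG.
rewrite -lee_fin; apply: le_trans (csum_le _) _; first by rewrite (le_lt_trans H)// ltry.
by rewrite [leRHS]EFinM lee_pmul2l.
Qed.

Lemma bracketC f g x : bracket g f x = ((bracket f g x)^*)%C.
Proof.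
rewrite /bracket /csum /conjc; congr (_ +i* _)%C.
  by apply: eq_rsum => k; rewrite !ReM !ReJ !ImJ; ring.
by rewrite -rsumN; apply: eq_rsum => k; rewrite !ImM !ReJ !ImJ; ring.
Qed.

Lemma rsum_ge0 (p : int -> R) : (forall k, 0 <= p k) ->
  rsum p = fine (\esum_(k in [set: int]) (p k)%:E).
Proof.
move=> p0; rewrite /rsum [X in _ - fine X]esum1 ?subr0.
  by congr fine; apply: eq_esum => k _; rewrite /funrpos max_l.
by move=> k _; rewrite /funrneg max_r// oppr_le0.
Qed.

Lemma csum_real (p : int -> R) : csum (fun k => (p k)%:C%C) = (rsum p)%:C%C.
Proof. by rewrite /csum /= rsum0. Qed.

(** Where [sqsum f x] is infinite, both sides are 0 by the convention for [fine]. *)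
Lemma bracket_diag f x : bracket f f x = (fine (sqsum f x))%:C%C.
Proof.
rewrite /bracket (_ : (fun k => _) = fun k => ((cabs (f (x - k%:~R / b))) ^+ 2)%:C%C).
  by rewrite csum_real rsum_ge0// => k; exact: sqr_ge0.
apply/funext => k; rewrite cabs_sqr; case: (f _) => u v /=.
by apply/eqP; rewrite eq_complex/=; apply/andP; split; apply/eqP; ring.
Qed.

Definition periodic_set E := forall x (n : int), E (x - n%:~R / b) <-> E x.

(** For periodic [E] this is the action on the module of a projection of the algebra; it passes
    through the inner product, which makes localization possible. *)
Definition cut E f (x : R) : R[i] := (\1_E x)%:C%C * f x.

Lemma cut_shift E f x n : periodic_set E ->
  cut E f (x - n%:~R / b) = (\1_E x)%:C%C * f (x - n%:~R / b).
Proof.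
by move=> pE; rewrite /cut !indicE; congr ((nat_of_bool _)%:R%:C%C * _); apply/idP/idP; rewrite !inE => /pE.
Qed.

Lemma cmeasurable_cut E f : measurable E -> cmeasurable setT f -> cmeasurable setT (cut E f).
Proof.
move=> mE mf; apply: cmeasurableM => //; split => /=.
  exact: measurable_indic.
exact: measurable_cst.
Qed.

Lemma cabs_indic E x : cabs (\1_E x : R)%:C%C = \1_E x.
Proof. by rewrite cabsE/= expr0n addr0 sqrtr_sqr ger0_norm. Qed.

Lemma sqsum_cut E f x : periodic_set E -> sqsum (cut E f) x = ((\1_E x)%:E * sqsum f x)%E.
Proof.
move=> pE; rewrite /sqsum -esumZl//; last by move=> k _; rewrite lee_fin sqr_ge0.
apply: eq_esum => k _; rewrite cut_shift// cabsM cabs_indic exprMn EFinM.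
by rewrite indicE; case: (_ \in _); rewrite ?expr1n ?expr0n.
Qed.

Lemma bracket_cut E f g x : periodic_set E -> bracket (cut E f) g x = (\1_E x)%:C%C * bracket f g x.
Proof.
move=> pE; rewrite /bracket /csum; apply/eqP; rewrite eq_complex/= !mul0r subr0 addr0 -!rsumZ.
apply/andP; split; apply/eqP; apply: eq_rsum => k; rewrite cut_shift// -mulrA.
  by rewrite ReM /= mul0r subr0.
by rewrite ImM /= mul0r addr0.
Qed.

End Brackets.

(** * Gabor coefficients as Fourier coefficients of the bracket *)

Section Coefficients.
Variables (R : realType) (b : R).
Hypothesis hb : 0 < b.
Local Notation mu := (@lebesgue_measure R).
Local Notation T := (b^-1).
Local Notation I := `[0, b^-1]%classic.
Implicit Types (f g h : R -> R[i]) (p c : R -> R).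

Let T0 : 0 < T. Proof. by rewrite invr_gt0. Qed.
Let mI : measurable (I : set (measurableTypeR R)). Proof. exact: measurable_itv. Qed.

Definition periodize p (x : R) : R := rsum (fun k : int => p (x - k%:~R / b)).

(** A finite integral forces [P] to be finite a.e., so [fine] changes it on a null set only. *)
Let fine_integral (P : R -> \bar R) : measurable_fun I P -> (forall x, 0 <= P x)%E ->
  (\int[mu]_(x in I) P x < +oo)%E ->
  mu.-integrable I (EFin \o (fun x => fine (P x))) /\
  (\int[mu]_(x in I) (fine (P x))%:E = \int[mu]_(x in I) P x)%E.
Proof.
move=> mP P0 Poo.
have iP : mu.-integrable I P.
  by apply/integrableP; split => //; under eq_integral do rewrite gee0_abs//.
have aeP : ae_eq mu I (fun x => (fine (P x))%:E) P.
  have H := integrable_ae mI iP.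
  by near=> x => Ix; rewrite fineK//; exact: (near H x _ Ix).
have mfP : measurable_fun I (fun x => (fine (P x))%:E).
  by apply/measurable_EFinP; exact: measurableT_comp.
have E : (\int[mu]_(x in I) (fine (P x))%:E = \int[mu]_(x in I) P x)%E.
  by apply: ge0_ae_eq_integral => // x _; rewrite lee_fin fine_ge0.
split => //; apply/integrableP; split => //.
by under eq_integral do rewrite /= ger0_norm ?fine_ge0//; rewrite E.
Unshelve. all: by end_near. Qed.

Lemma integral_periodize p : mu.-integrable setT (EFin \o p) ->
  mu.-integrable I (EFin \o periodize p) /\
  \int[mu]_x p x = \int[mu]_(x in I) periodize p x.
Proof.
move=> ip; have mp : measurable_fun setT p by apply/measurable_EFinP; exact: measurable_int ip.
have part (q : R -> R) : (forall x, 0 <= q x) -> mu.-integrable setT (EFin \o q) ->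
    [/\ mu.-integrable I (EFin \o (fun x => fine (\esum_(k in [set: int]) (q (x - k%:~R / b))%:E))) &
        \int[mu]_x q x = \int[mu]_(x in I) fine (\esum_(k in [set: int]) (q (x - k%:~R / b))%:E)].
  move=> q0 iq; have mq : measurable_fun setT (EFin \o q) by exact: measurable_int iq.
  have E := ge0_integral_periodize hb mq (fun x => q0 x : (0 <= (q x)%:E)%E).
  have [| | |H1 H2] := @fine_integral (fun x => \esum_(k in [set: int]) (q (x - k%:~R / b))%:E).
  - apply: measurable_fun_esum => // [k|k x]; last by rewrite lee_fin.
    by apply: measurable_funTS; exact: (emeasurable_fun_shift _ mq).
  - by move=> x; apply: esum_ge0 => k _; rewrite lee_fin.
  - by rewrite -E; exact: integrable_lty iq.
  by split => //; rewrite /Rintegral H2 -E.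
have [i1 e1] := part _ (fun x => funrpos_ge0 p x) (integrable_funrpos measurableT ip).
have [i2 e2] := part _ (fun x => funrneg_ge0 p x) (integrable_funrneg measurableT ip).
split; first exact: (integrable_subr mI i1 i2).
rewrite /periodize /rsum RintegralB// -e1 -e2 -RintegralB//; last 2 first.
- exact: integrable_funrpos.
- exact: integrable_funrneg.
by apply: eq_Rintegral => x _; rewrite -[in LHS](funrposBneg p).
Qed.

Lemma periodize_mul c p x : (forall y (k : int), c (y - k%:~R / b) = c y) ->
  periodize (fun y => c y * p y) x = c x * periodize p x.
Proof. by move=> cp; rewrite /periodize -rsumZ; apply: eq_rsum => k; rewrite cp. Qed.

Let cosP m (y : R) (k : int) : cos (freq b m * (y - k%:~R / b)) = cos (freq b m * y).
Proof. by rewrite -mulNr -intrN cos_freqD. Qed.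
Let sinP m (y : R) (k : int) : sin (freq b m * (y - k%:~R / b)) = sin (freq b m * y).
Proof. by rewrite -mulNr -intrN sin_freqD. Qed.

Let pr f h x := complex.Re (f x * (h x)^*%C).
Let pim f h x := complex.Im (f x * (h x)^*%C).

Let integrable_cross f h : L2 f -> L2 h ->
  mu.-integrable setT (EFin \o pr f h) /\ mu.-integrable setT (EFin \o pim f h).
Proof.
move=> [mf foo] [mh hoo].
suff : cintegrable setT (fun x => f x * (h x)^*%C) by [].
have mm : cmeasurable setT (fun x => f x * (h x)^*%C).
  by apply: cmeasurableM => //; exact: cmeasurableJ.
apply: cintegrable_cabs => //.
apply: le_lt_trans (lte_add_pinfty foo hoo).
rewrite /L2normsq -ge0_integralD//; last 4 first.
- by move=> x _; rewrite lee_fin sqr_ge0.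
- exact: measurable_cabs2.
- by move=> x _; rewrite lee_fin sqr_ge0.
- exact: measurable_cabs2.
apply: ge0_le_integral => //.
- by move=> x _; rewrite lee_fin cabs_ge0.
- by apply/measurable_EFinP; exact: measurable_cabs mm.
- by apply: emeasurable_funD; exact: measurable_cabs2.
- move=> x _; rewrite -EFinD lee_fin cabsM cabsJ.
  by have := cabs_ge0 (f x); have := cabs_ge0 (h x); nra.
Qed.

Let bounded_mul c p : continuous c -> (forall x, `|c x| <= 1) ->
  mu.-integrable setT (EFin \o p) -> mu.-integrable setT (EFin \o (fun x => c x * p x)).
Proof.
move=> cc c1 ip; have mp : measurable_fun setT p by apply/measurable_EFinP; exact: measurable_int ip.
apply: (integrable_le measurableT _ _ (integrable_norm ip)).
  by apply: measurable_funM => //; exact: continuous_measurable_fun.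
by move=> x _; rewrite normrM /= ler_piMl.
Qed.

Let C m (U : R -> R) := \int[mu]_(x in I) (cos (freq b m * x) * U x).
Let S m (U : R -> R) := \int[mu]_(x in I) (sin (freq b m * x) * U x).

(** The exponential has period 1/b and so factors out of the periodization of [f] times the
    conjugate of [h], which is the bracket. The right-hand side is the integral over [I] of
    [exp (- i * freq b m * x)] times [U + i V]. *)
Lemma gabor_coef f h m : L2 f -> L2 h ->
  let U x := complex.Re (bracket b f h x) in let V x := complex.Im (bracket b f h x) in
  L2ip f (modulation (m%:~R * b) h) = ((C m U + S m V) +i* (C m V - S m U))%C.
Proof.
move=> Lf Lh U V; have [ip iq] := integrable_cross Lf Lh.
have cM : continuous (fun x : R => cos (freq b m * x)) by exact: continuous_cosM.
have sM : continuous (fun x : R => sin (freq b m * x)) by exact: continuous_sinM.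
have c1 (x : R) : `|cos (freq b m * x)| <= 1 by exact: cos_max.
have s1 (x : R) : `|sin (freq b m * x)| <= 1 by exact: sin_max.
have per (c p : R -> R) : continuous c -> (forall x, `|c x| <= 1) ->
    (forall y (k : int), c (y - k%:~R / b) = c y) -> mu.-integrable setT (EFin \o p) ->
    \int[mu]_x (c x * p x) = \int[mu]_(x in I) (c x * periodize p x).
  move=> cc cb cp ip'; rewrite (integral_periodize (bounded_mul cc cb ip')).2.
  by apply: eq_Rintegral => x _; exact: periodize_mul.
have E x : f x * (modulation (m%:~R * b) h x)^*%C =
    ((cos (freq b m * x) * pr f h x + sin (freq b m * x) * pim f h x) +i*
     (cos (freq b m * x) * pim f h x - sin (freq b m * x) * pr f h x))%C.
  rewrite /modulation /expi (_ : 2 * pi * (m%:~R * b) * x = freq b m * x); last first.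
    by rewrite /freq; ring.
  rewrite /pr /pim; case: (f x) (h x) => u1 u2 [v1 v2].
  by apply/eqP; rewrite eq_complex/=; apply/andP; split; apply/eqP; ring.
rewrite /L2ip /cintegral; under eq_Rintegral do rewrite /= E /=.
under [X in (_ +i* X)%C]eq_Rintegral do rewrite /= E /=.
rewrite RintegralD//; [|exact: bounded_mul|exact: bounded_mul].
rewrite RintegralB//; [|exact: bounded_mul|exact: bounded_mul].
by rewrite !per//.
Qed.

(* Complex coefficients of index m and -m are combinations of the four real cosine and
   sine coefficients of [U] and [V], and so are the Hartley coefficients; the squares
   agree only after pairing m with -m. *)
Lemma gabor_parseval f h : L2 f -> L2 h ->
  let U x := complex.Re (bracket b f h x) in let V x := complex.Im (bracket b f h x) in
  sqint mu I U -> sqint mu I V ->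
  (\esum_(m in [set: int]) ((cabs (L2ip f (modulation (m%:~R * b) h))) ^+ 2)%:E =
   (b^-1)%:E * \int[mu]_(x in I) ((cabs (bracket b f h x)) ^+ 2)%:E)%E.
Proof.
move=> Lf Lh U V sU sV.
have [_ eU] := parseval_cas hb sU; have [_ eV] := parseval_cas hb sV.
have -> : (\int[mu]_(x in I) ((cabs (bracket b f h x)) ^+ 2)%:E = (ip mu I U U + ip mu I V V)%:E)%E.
  under eq_integral do rewrite cabs_sqr.
  rewrite -RintegralD//; [|exact: sqint_mul|exact: sqint_mul].
  rewrite (EFin_Rintegral mI (integrable_addr mI (sqint_mul mI sU sU) (sqint_mul mI sV sV))).
  by apply: eq_integral => x _; rewrite !expr2.
rewrite -EFinM mulrDr EFinD -eU -eV /energy -esumD//; last 2 first.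
- by move=> m _; rewrite lee_fin sqr_ge0.
- by move=> m _; rewrite lee_fin sqr_ge0.
apply: esum_int_symm.
- by move=> m; rewrite lee_fin sqr_ge0.
- by move=> m; rewrite -EFinD lee_fin addr_ge0 ?sqr_ge0.
have coefE (W : R -> R) m : sqint mu I W -> ip mu I W (cas b m) = C m W + S m W.
  move=> sW; rewrite /ip /C /S -RintegralD//; last 2 first.
  - by apply: (sqint_mul mI) => //; apply: continuous_sqint; exact: continuous_cosM.
  - by apply: (sqint_mul mI) => //; apply: continuous_sqint; exact: continuous_sinM.
  by apply: eq_Rintegral => x _; rewrite /cas; ring.
have CN m W : C (- m) W = C m W.
  by apply: eq_Rintegral => x _; rewrite freqN mulNr cosN.
have SN m W : sqint mu I W -> S (- m) W = - S m W.
  move=> sW; rewrite -[RHS]mulN1r /S -RintegralZl//; last first.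
    by apply: (sqint_mul mI) => //; apply: continuous_sqint; exact: continuous_sinM.
  by apply: eq_Rintegral => x _; rewrite freqN mulNr sinN mulN1r mulNr.
move=> m; rewrite !gabor_coef// !coefE// !CN !SN// !cabs_sqr/= -!EFinD; congr EFin.
by rewrite -/U -/V; move: (C m U) (C m V) (S m U) (S m V) => c1 c2 s1 s2; ring.
Qed.

End Coefficients.

(** * Localization and the frame inequalities *)

Section Localization.
Variables (R : realType) (b : R).
Hypothesis hb : 0 < b.
Local Notation mu := (@lebesgue_measure R).
Local Notation I := `[0, b^-1]%classic.
Implicit Types (E : set R) (u v : R -> \bar R).

Let mI : measurable (I : set (measurableTypeR R)). Proof. exact: measurable_itv. Qed.
Let muIoo : (mu I < +oo)%E.
Proof. by rewrite lebesgue_measure_itv/= lte_fin invr_gt0 hb -EFinD ltry. Qed.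

Definition periodic u := forall x (n : int), u (x - n%:~R / b) = u x.

Lemma measurable_indicM E u : measurable E -> measurable_fun setT u ->
  measurable_fun setT (fun x => ((\1_E x)%:E * u x)%E).
Proof.
move=> mE mu_; apply: emeasurable_funM => //.
by apply/measurable_EFinP; exact: measurable_indic.
Qed.

Lemma indicM_ge0 E x (c : \bar R) : (0 <= c)%E -> (0 <= (\1_E x)%:E * c)%E.
Proof. by move=> c0; rewrite mule_ge0// lee_fin. Qed.

Lemma indicM_in E x (c : \bar R) : E x -> ((\1_E x)%:E * c = c)%E.
Proof. by move=> Ex; rewrite indicE mem_set// mul1e. Qed.

Lemma indicM_out E x (c : \bar R) : ~ E x -> ((\1_E x)%:E * c = 0)%E.
Proof. by move=> Ex; rewrite indicE memNset// mul0e. Qed.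

(* Test with [E = {v < u <= j}]. *)
Lemma ae_le_of_integral_le u v :
  measurable_fun setT u -> measurable_fun setT v ->
  (forall x, 0 <= u x)%E -> (forall x, 0 <= v x)%E -> periodic u -> periodic v ->
  (forall E (j : R), measurable E -> periodic_set b E -> (forall x, E x -> (u x <= j%:E)%E) ->
    (\int[mu]_(x in I) ((\1_E x)%:E * u x) <= \int[mu]_(x in I) ((\1_E x)%:E * v x))%E) ->
  {ae mu, forall x, I x -> (u x < +oo)%E -> (u x <= v x)%E}.
Proof.
move=> mu_ mv u0 v0 pu pv H.
have step (j : nat) : {ae mu, forall x, I x -> (u x <= j%:R%:E)%E -> (u x <= v x)%E}.
  pose E := [set x | (v x < u x)%E] `&` [set x | (u x <= j%:R%:E)%E].
  have mE : measurable E.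
    have -> : E = setT `&` [set x | (v x < u x)%E] `\` (setT `&` [set x | (j%:R%:E < u x)%E]).
      rewrite !setTI; apply/seteqP; split => x /= [vu uj]; split => //.
        by apply/negP; rewrite -leNgt.
      by rewrite /= leNgt; apply/negP.
    by apply: measurableD; [exact: measurable_lte|exact: emeasurable_fun_o_infty].
  have pE : periodic_set b E by move=> x n; rewrite /E /= pu pv.
  have uE x : E x -> (u x <= j%:R%:E)%E by case.
  have {}H := H E j%:R mE pE uE.
  have vfin x : E x -> v x \is a fin_num.
    by move=> [/= vu uj]; rewrite ge0_fin_numE// (lt_le_trans vu)// (le_trans uj)// leey.
  (* [w] is nonnegative with zero integral, hence zero a.e., but it is positive on [E]. *)
  pose w x := ((\1_E x)%:E * (u x - v x))%E.
  have w0 x : (0 <= w x)%E.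
    have [Ex|nE] := pselect (E x); last by rewrite /w indicM_out.
    by rewrite /w indicM_in// sube_ge0 ?vfin//; case: Ex => /ltW.
  have mw : measurable_fun setT w by apply: measurable_indicM => //; exact: emeasurable_funB.
  have E1 x : ((\1_E x)%:E * u x = w x + (\1_E x)%:E * v x)%E.
    have [Ex|nE] := pselect (E x); last by rewrite /w !indicM_out// adde0.
    by rewrite /w !indicM_in// subeK// vfin.
  (* On [E] also [v] is below [j]; finiteness allows this integral to be cancelled from both sides
     of [H]. *)
  have voo : (\int[mu]_(x in I) ((\1_E x)%:E * v x) < +oo)%E.
    apply: (@le_lt_trans _ _ (\int[mu]_(x in I) cst j%:R%:E x)%E); last first.
      by rewrite integral_cst// lte_mul_pinfty.
    apply: ge0_le_integral => //.
    - by move=> x _; exact: indicM_ge0.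
    - by apply: measurable_funTS; exact: measurable_indicM.
    move=> x _; have [Ex|nE] := pselect (E x); last by rewrite indicM_out// lee_fin.
    by rewrite indicM_in//; case: Ex => vu uj; rewrite (le_trans (ltW vu)).
  have Iw0 : (\int[mu]_(x in I) `|w x| = 0)%E.
    under eq_integral do rewrite gee0_abs//.
    apply/eqP; rewrite eq_le integral_ge0// andbT.
    move: H; under [X in (X <= _)%E -> _]eq_integral do rewrite E1.
    rewrite ge0_integralD//; last 3 first.
    - by apply: measurable_funTS.
    - by move=> x _; exact: indicM_ge0.
    - by apply: measurable_funTS; exact: measurable_indicM.
    rewrite -[X in (_ <= X)%E -> _]add0e leeD2rE// ge0_fin_numE//.
    by apply: integral_ge0 => x _; exact: indicM_ge0.
  have mwI : measurable_fun I w by exact: measurable_funTS.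
  have ae0 := (ae_eq_integral_abs mu mI mwI).1 Iw0.
  near=> x => Ix uj; rewrite leNgt; apply/negP => vu.
  have Ex : E x by [].
  have : w x = 0%E by exact: (near ae0 x _ Ix).
  rewrite /w indicM_in// => /eqP; rewrite eq_le sube_le0 leNgt vu//.
have aeH := ae_foralln step.
near=> x => Ix uoo; have : u x \is a fin_num by rewrite ge0_fin_numE.
move=> /fineK uE; have [j /ltW uj] : exists j : nat, fine (u x) < j%:R.
  by exists (Num.bound (fine (u x))); rewrite archi_boundP ?fine_ge0.
apply: (near aeH x _ j) => //; by rewrite -uE lee_fin.
Unshelve. all: by end_near. Qed.

(** Monotone convergence along the sets [s < j], which exhaust [I] up to a null set because [s] is
    finite a.e. *)
Lemma integral_le_of_cuts (q s : R -> \bar R) (K : \bar R) :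
  measurable_fun setT q -> measurable_fun setT s -> (forall x, 0 <= q x)%E ->
  {ae mu, forall x, I x -> (s x < +oo)%E} ->
  (forall j : nat, \int[mu]_(x in I) ((\1_[set y | (s y < j%:R%:E)%E] x)%:E * q x) <= K)%E ->
  (\int[mu]_(x in I) q x <= K)%E.
Proof.
move=> mq ms q0 soo H.
pose E (j : nat) := [set y | (s y < j%:R%:E)%E].
have mE j : measurable (E j).
  by rewrite -[E j]setTI; exact: emeasurable_fun_infty_o.
pose g (j : nat) x := ((\1_(E j) x)%:E * q x)%E.
have mg j : measurable_fun I (g j) by apply: measurable_funTS; exact: measurable_indicM.
have ndg x : {homo g^~ x : n m / (n <= m)%N >-> (n <= m)%E}.
  move=> n m nm; rewrite /g; have [En|nE] := pselect (E n x); last by rewrite indicM_out// indicM_ge0.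
  rewrite !indicM_in//; rewrite /E /= (lt_le_trans En)// lee_fin ler_nat//.
have cg x : cvgn (g^~ x) by apply: ereal_nondecreasing_is_cvgn => n m; exact: ndg.
have E1 : (\int[mu]_(x in I) q x <= \int[mu]_(x in I) limn (g^~ x))%E.
  apply: ae_ge0_le_integral => //.
  - exact: measurable_funTS.
  - by move=> x _; apply: lime_ge => //; apply: nearW => n; exact: indicM_ge0.
  - apply: emeasurable_fun_cvg => //.
      exact: mg.
  near=> x => Ix; have sx : (s x < +oo)%E by exact: (near soo x _ Ix).
  have [j sj] : exists j : nat, (s x < j%:R%:E)%E.
    case: (s x) sx => [r| |]// _; last by exists 0%N; rewrite ltNyr.
    by exists (Num.bound `|r|); rewrite lte_fin (le_lt_trans (ler_norm r))// archi_boundP.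
  apply: lime_ge => //; near=> n; rewrite /g indicM_in// /E /= (lt_le_trans sj)//.
  by rewrite lee_fin ler_nat; near: n; exact: nbhs_infty_ge.
apply: le_trans E1 _; rewrite (monotone_convergence _ mI)//; last 1 first.
- by move=> n x _; exact: indicM_ge0.
apply: lime_le; last by apply: nearW => n; exact: H.
apply: ereal_nondecreasing_is_cvgn => n m nm; apply: ge0_le_integral; [by []|by move=> x _; exact: indicM_ge0|exact: mg|exact: mg|].
by move=> x _; exact: ndg.
Unshelve. all: by end_near. Qed.

End Localization.

Lemma esum_prod_int (R : realType) (p : int * int -> \bar R) : (forall mn, 0 <= p mn)%E ->
  (\esum_(mn in [set: int * int]) p mn =
   \esum_(n in [set: int]) \esum_(m in [set: int]) p (m, n))%E.
Proof.
move=> p0; rewrite (esum_esum (J := fun=> setT) (a := fun n m => p (m, n)))//.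
apply: (@reindex_esum _ _ _ _ _ (fun nm : int * int => (nm.2, nm.1))).
by split => [//|[? ?] [? ?] _ _ [-> ->]//|[m n] _]; exists (n, m).
Qed.

(** * Equivalence of the frame inequalities, for an arbitrary sequence in [L2] *)

Section FrameEquivalence.
Variables (R : realType) (b : R).
Hypothesis hb : 0 < b.
Local Notation mu := (@lebesgue_measure R).
Local Notation T := (b^-1).
Local Notation I := `[0, b^-1]%classic.
Implicit Types (f h : R -> R[i]) (E : set R).
Variable g_ : int -> R -> R[i].
Hypothesis Lg : forall n, L2 (g_ n).

Let T0 : 0 < T. Proof. by rewrite invr_gt0. Qed.
Let mI : measurable (I : set (measurableTypeR R)). Proof. exact: measurable_itv. Qed.

Let muIE : mu I = T%:E.
Proof. by rewrite lebesgue_measure_itv/= lte_fin T0 -EFinD subr0. Qed.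

Definition frame_sum f : \bar R :=
  \esum_(n in [set: int]) \esum_(m in [set: int])
    ((cabs (L2ip f (modulation (m%:~R * b) (g_ n)))) ^+ 2)%:E.

Definition bracket_sum f (x : R) : \bar R :=
  \esum_(n in [set: int]) ((cabs (bracket b f (g_ n) x)) ^+ 2)%:E.

Lemma bracket_sum_ge0 f x : (0 <= bracket_sum f x)%E.
Proof. by apply: esum_ge0 => n _; rewrite lee_fin sqr_ge0. Qed.

Lemma measurable_bracket_sum f : cmeasurable setT f -> measurable_fun setT (bracket_sum f).
Proof.
move=> mf; apply: measurable_fun_esum => [n|n x]; last by rewrite lee_fin sqr_ge0.
by apply: measurable_cabs2; apply: cmeasurable_bracket => //; case: (Lg n).
Qed.

Lemma bracket_sum_periodic f : periodic b (bracket_sum f).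
Proof. by move=> x k; apply: eq_esum => n _; rewrite bracket_periodic. Qed.

Lemma bracket_sum_cut E f x : periodic_set b E ->
  bracket_sum (cut E f) x = ((\1_E x)%:E * bracket_sum f x)%E.
Proof.
move=> pE; rewrite /bracket_sum -esumZl//; last by move=> k _; rewrite lee_fin sqr_ge0.
apply: eq_esum => n _; rewrite bracket_cut// cabsM cabs_indic exprMn EFinM.
by rewrite indicE; case: (_ \in _); rewrite ?expr1n ?expr0n.
Qed.

Lemma gabor_parseval_lty f h : L2 f -> L2 h ->
  (\int[mu]_(x in I) ((cabs (bracket b f h x)) ^+ 2)%:E < +oo)%E ->
  (\esum_(m in [set: int]) ((cabs (L2ip f (modulation (m%:~R * b) h))) ^+ 2)%:E =
   T%:E * \int[mu]_(x in I) ((cabs (bracket b f h x)) ^+ 2)%:E)%E.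
Proof.
move=> Lf Lh oo.
have mB : cmeasurable setT (bracket b f h).
  by apply: cmeasurable_bracket; [case: Lf|case: Lh].
have i2 : mu.-integrable I (EFin \o (fun x => (cabs (bracket b f h x)) ^+ 2)).
  apply/integrableP; split; first by apply: measurable_funTS; exact: measurable_cabs2.
  by under eq_integral do rewrite /= ger0_norm ?sqr_ge0//.
have [mr mi] := mB.
apply: gabor_parseval => //; split.
- exact: measurable_funTS mr.
- apply: (integrable_le mI _ _ i2).
    by apply: measurable_funTS; apply: measurable_funX.
  by move=> x _; rewrite ger0_norm ?sqr_ge0// cabs_sqr lerDl sqr_ge0.
- exact: measurable_funTS mi.
- apply: (integrable_le mI _ _ i2).
    by apply: measurable_funTS; apply: measurable_funX.
  by move=> x _; rewrite ger0_norm ?sqr_ge0// cabs_sqr lerDr sqr_ge0.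
Qed.

(** The bound of [cabs_bracket_le] grows like the square root of [sqsum b f], so its square is
    integrable. *)
Lemma bracket_sqr_lty f h : L2 f -> Linfl2 b h ->
  (\int[mu]_(x in I) ((cabs (bracket b f h x)) ^+ 2)%:E < +oo)%E.
Proof.
move=> Lf Lh; have mh := (Linfl2_L2 hb Lh).1; have [mf _] := Lf.
have foo := sqsum_lty hb Lf; have /Linfl2P[_ [M hM]] := Lh.
have sqM := measurable_sqsum b mf.
pose K := (2 * (1 + M)) ^+ 2.
apply: (@le_lt_trans _ _ (\int[mu]_(x in I) (K%:E * (sqsum b f x + cst 1%:E x)))%E).
  apply: ae_ge0_le_integral => //.
  - by move=> x _; rewrite lee_fin sqr_ge0.
  - by apply: measurable_funTS; apply: measurable_cabs2; exact: cmeasurable_bracket.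
  - by move=> x _; rewrite mule_ge0 ?lee_fin ?sqr_ge0// adde_ge0// ?sqsum_ge0// lee_fin.
  - apply: measurable_funTS; apply: measurable_funeM; apply: emeasurable_funD => //.
  near=> x => Ix; have sfoo : (sqsum b f x < +oo)%E by exact: (near foo x _ Ix).
  have sh : (sqsum b h x <= M%:E)%E by exact: (near hM x _ Ix).
  have sE : (fine (sqsum b f x))%:E = sqsum b f x by rewrite fineK// ge0_fin_numE// sqsum_ge0.
  have F0 : 0 <= fine (sqsum b f x) by rewrite fine_ge0// sqsum_ge0.
  rewrite -sE /= -EFinD -EFinM lee_fin.
  have := @cabs_bracket_le _ b f h x (fine (sqsum b f x)) M F0.
  rewrite sE => /(_ (lexx _) sh) le1.
  have : (cabs (bracket b f h x)) ^+ 2 <= (2 * ((1 + M) * Num.sqrt (fine (sqsum b f x) + 1))) ^+ 2.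
    by rewrite ler_pXn2r// ?nnegrE ?cabs_ge0// (le_trans (cabs_ge0 _) le1).
  have F1 : 0 <= fine (sqsum b f x) + 1 by exact: addr_ge0.
  by rewrite mulrA exprMn (sqr_sqrtr F1).
rewrite ge0_integralZl//; last 3 first.
- by apply: measurable_funTS; apply: emeasurable_funD.
- by move=> x _; rewrite adde_ge0// ?sqsum_ge0// lee_fin.
- by rewrite lee_fin sqr_ge0.
rewrite lte_mul_pinfty ?lee_fin ?sqr_ge0// ge0_integralD//; last 2 first.
- by move=> x _; exact: sqsum_ge0.
- exact: measurable_funTS.
rewrite -L2normsq_sqsum// lte_add_pinfty//; first by case: Lf.
by rewrite integral_cst// [X in (_ * X)%E]muIE -EFinM ltry.
Unshelve. all: by end_near. Qed.

Lemma frame_sum_integral f : L2 f -> (forall n, Linfl2 b (g_ n)) ->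
  frame_sum f = (T%:E * \int[mu]_(x in I) bracket_sum f x)%E.
Proof.
move=> Lf Lg'; have [mf _] := Lf.
rewrite /frame_sum; under eq_esum do rewrite gabor_parseval_lty// ?bracket_sqr_lty//.
rewrite esumZl ?(ltW T0)//; last first.
  by move=> n _; apply: integral_ge0 => x _; rewrite lee_fin sqr_ge0.
rewrite -integral_esum//; last by move=> n x; rewrite lee_fin sqr_ge0.
move=> n; apply: measurable_funTS; apply: measurable_cabs2.
by apply: cmeasurable_bracket => //; case: (Lg n).
Qed.

Lemma Linfl2_cut f E : measurable E -> periodic_set b E -> Linfl2 b f -> Linfl2 b (cut E f).
Proof.
move=> mE pE /Linfl2P[mf [M fM]]; apply/Linfl2P; split; first exact: cmeasurable_cut.
exists M; near=> x => Ix; rewrite sqsum_cut//.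
have fx : (sqsum b f x <= M%:E)%E by exact: (near fM x _ Ix).
have [Ex|nE] := pselect (E x); first by rewrite indicM_in.
by rewrite indicM_out// (le_trans (sqsum_ge0 b f x)).
Unshelve. all: by end_near. Qed.

(* With [s = sqsum (g_ n)] and [f = cut E (g_ n)], the [n]-th term of the frame sum
   alone is [T * \int_E s^2], whereas [L2normsq f = \int_E s]. *)
Lemma sqsum_le_of_frame (B : R) n : 0 < B ->
  (forall f, L2 f -> (frame_sum f <= B%:E * L2normsq f)%E) ->
  {ae mu, forall x, I x -> (sqsum b (g_ n) x <= (b * B)%:E)%E}.
Proof.
move=> B0 HB; set s := sqsum b (g_ n); have [mg goo] := Lg n.
have ms : measurable_fun setT s by exact: measurable_sqsum.
have s0 x : (0 <= s x)%E by exact: sqsum_ge0.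
have ps : periodic b s by move=> x k; exact: sqsum_periodic.
have bB0 : 0 <= b * B by rewrite mulr_ge0// ltW.
(* The localized frame bound gives s^2 <= bB s; one factor [s] is divided out at the end. *)
have H : {ae mu, forall x, I x -> (s x * s x < +oo)%E -> (s x * s x <= (b * B)%:E * s x)%E}.
  apply: (ae_le_of_integral_le hb) => //.
  - exact: emeasurable_funM.
  - exact: measurable_funeM.
  - by move=> x; rewrite mule_ge0.
  - by move=> x; rewrite mule_ge0.
  - by move=> x k; rewrite ps.
  - by move=> x k; rewrite ps.
  move=> E j mE pE sj.
  (* From r <= 1 + r^2: a bound on [s x * s x] also bounds [s x]. *)
  have sE x : E x -> (s x <= (1 + j)%:E)%E.
    move=> Ex; move: (sj x Ex) (s0 x); case: (s x) => [r| |]; [|by rewrite mulyy|by rewrite leeNy_eq].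
    by rewrite -EFinM !lee_fin => rj r0; nra.
  have sfin x : E x -> (fine (s x))%:E = s x.
    by move=> Ex; rewrite fineK// ge0_fin_numE// (le_lt_trans (sE x Ex))// ltry.
  pose f := cut E (g_ n).
  have sf x : sqsum b f x = ((\1_E x)%:E * s x)%E by exact: sqsum_cut.
  have br x : ((cabs (bracket b f (g_ n) x)) ^+ 2)%:E = ((\1_E x)%:E * (s x * s x))%E.
    rewrite bracket_cut// cabsM cabs_indic bracket_diag.
    have [Ex|nE] := pselect (E x); last first.
      by rewrite indicM_out// indicE memNset// mul0r expr0n.
    rewrite indicM_in// indicE mem_set// mul1r -(sfin x Ex) -EFinM.
    by rewrite cabsE/= expr0n addr0 sqrtr_sqr real_normK ?num_real// expr2.
  have Lf : Linfl2 b f.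
    apply/Linfl2P; split; first exact: cmeasurable_cut.
    exists (1 + `|j|); near=> x => Ix; rewrite sf.
    have [Ex|nE] := pselect (E x); last by rewrite indicM_out// lee_fin addr_ge0.
    by rewrite indicM_in// (le_trans (sE x Ex))// lee_fin lerD2l ler_norm.
  have Lf2 := Linfl2_L2 hb Lf.
  have broo : (\int[mu]_(x in I) ((cabs (bracket b f (g_ n) x)) ^+ 2)%:E < +oo)%E.
    (* Arguments are swapped, since [f] is the one known to lie in [Linfl2]. *)
    under eq_integral do rewrite bracketC cabsJ.
    exact: bracket_sqr_lty.
  have := HB f Lf2; rewrite (L2normsq_sqsum hb); last by case: Lf2.
  under eq_integral do rewrite sf.
  have le1 : (\esum_(m in [set: int]) ((cabs (L2ip f (modulation (m%:~R * b) (g_ n)))) ^+ 2)%:E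
             <= frame_sum f)%E.
    have := @sum_le_esum R int [set: int] (fun n => \esum_(m in [set: int])
      ((cabs (L2ip f (modulation (m%:~R * b) (g_ n)))) ^+ 2)%:E)%E [fset n]%fset (@subsetT _ _).
    by rewrite big_seq_fset1.
  move=> /(le_trans le1); rewrite gabor_parseval_lty//.
  under [X in (_ * X <= _)%E -> _]eq_integral do rewrite br.
  move=> le2; have := @lee_wpmul2l _ b%:E (ltW hb : (0 <= b%:E)%E) _ _ le2.
  rewrite !muleA -!EFinM mulfV ?gt_eqF// mul1e => /le_trans; apply.
  rewrite -ge0_integralZl//; last 2 first.
  - by apply: measurable_funTS; exact: measurable_indicM.
  - by move=> x _; exact: indicM_ge0.
  by under eq_integral do rewrite muleCA.
near=> x => Ix; have sx : (s x < +oo)%E by exact: (near (sqsum_lty hb (Lg n)) x _ Ix).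
have := near H x _ Ix; move: sx (s0 x); case: (s x) => [r| |]// _ r0.
rewrite -!EFinM !lee_fin in r0 *; move=> /(_ _ (ltry _)) H'.
have {}H' : r * r <= b * B * r by exact: H'.
by have [r0'|r0'] := eqVneq r 0; [rewrite r0'|rewrite -(@ler_pM2r _ r)// lt_def r0' r0].
Unshelve. all: by end_near. Qed.

Lemma mod_ip_bracket f h : Linfl2 b f -> Linfl2 b h ->
  cmeasurable I (mod_ip b f h) /\ {ae mu, forall x, I x -> mod_ip b f h x = bracket b f h x}.
Proof.
move=> /Linfl2P[mf [M fM]] /Linfl2P[mh [N hN]].
have meas k : cmeasurable setT (fun x => f (x - k%:~R / b) * (h (x - k%:~R / b))^*%C).
  by apply: cmeasurableM; [exact: cmeasurable_shift|apply: cmeasurableJ; exact: cmeasurable_shift].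
apply: mod_ip_wstar; apply: (wstar_sum_csum (M := (1 + N) * Num.sqrt (`|M| + 1))).
- by move=> k; have [? ?] := meas k; split; exact: measurable_funTS.
- by have [? ?] := cmeasurable_bracket b mf mh; split; exact: measurable_funTS.
- near=> x => Ix; apply: abs_sum_sqrt_le => //.
    by rewrite (le_trans (near fM x _ Ix))// lee_fin ler_norm.
  exact: (near hN x _ Ix).
- by apply: aeW => x _.
Unshelve. all: by end_near. Qed.

Lemma bracketM_conj f h x :
  bracket b f h x * bracket b h f x = ((cabs (bracket b f h x)) ^+ 2)%:C%C.
Proof.
rewrite (bracketC b f h) cabs_sqr; case: (bracket b f h x) => u v.
by apply/eqP; rewrite eq_complex/=; apply/andP; split; apply/eqP; ring.
Qed.

Lemma mod_ip_frame_terms f : Linfl2 b f -> (forall n, Linfl2 b (g_ n)) ->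
  {ae mu, forall x, forall n, I x ->
    mod_ip b f (g_ n) x * mod_ip b (g_ n) f x = ((cabs (bracket b f (g_ n) x)) ^+ 2)%:C%C}.
Proof.
move=> Lf Lg'; apply: ae_forall_int => n.
have [_ e1] := mod_ip_bracket Lf (Lg' n); have [_ e2] := mod_ip_bracket (Lg' n) Lf.
by near=> x => Ix; rewrite (near e1 x)// (near e2 x)// bracketM_conj.
Unshelve. all: by end_near. Qed.

Lemma modular_frame_of_frame (A B : R) : 0 < A -> 0 < B ->
  (forall f, L2 f -> (A%:E * L2normsq f <= frame_sum f)%E /\
                     (frame_sum f <= B%:E * L2normsq f)%E) ->
  nonstandard_modular_frame b g_.
Proof.
move=> A0 B0 HAB.
have Lg' n : Linfl2 b (g_ n).
  apply/Linfl2P; split; first by case: (Lg n).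
  exists (b * B); apply: sqsum_le_of_frame => // f Lf; exact: (HAB f Lf).2.
split => //; exists (b * A), (b * B); split; [exact: mulr_gt0|exact: mulr_gt0|].
move=> f Lf; have Lf2 := Linfl2_L2 hb Lf; have [mf foo] := Lf2.
set s := sqsum b f; pose p := bracket_sum f.
have ms : measurable_fun setT s by exact: measurable_sqsum.
have s0 x : (0 <= s x)%E by exact: sqsum_ge0.
have ps : periodic b s by move=> x k; exact: sqsum_periodic.
have mp : measurable_fun setT p by exact: measurable_bracket_sum.
have p0 x : (0 <= p x)%E by exact: bracket_sum_ge0.
have pp : periodic b p by exact: bracket_sum_periodic.
have b0 : (0 <= b%:E)%E by rewrite lee_fin ltW.
have normE E : measurable E -> periodic_set b E ->
    L2normsq (cut E f) = (\int[mu]_(x in I) ((\1_E x)%:E * s x))%E.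
  move=> mE pE; rewrite (L2normsq_sqsum hb); last exact: cmeasurable_cut.
  by under eq_integral do rewrite sqsum_cut//.
have sumE E : measurable E -> periodic_set b E ->
    (b%:E * frame_sum (cut E f) = \int[mu]_(x in I) ((\1_E x)%:E * p x))%E.
  move=> mE pE; rewrite frame_sum_integral//; last by apply: (Linfl2_L2 hb); exact: Linfl2_cut.
  rewrite muleA -EFinM mulfV ?gt_eqF// mul1e.
  by under eq_integral do rewrite bracket_sum_cut//.
have scal (K : R) E : 0 <= K -> measurable E -> periodic_set b E ->
    (\int[mu]_(x in I) ((\1_E x)%:E * ((b * K)%:E * s x)) =
     b%:E * (K%:E * L2normsq (cut E f)))%E.
  move=> K0 mE pE; rewrite normE// muleA -EFinM -ge0_integralZl//.
  - by under eq_integral do rewrite muleCA.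
  - by apply: measurable_funTS; exact: measurable_indicM.
  - by move=> x _; exact: indicM_ge0.
  - by rewrite lee_fin mulr_ge0// ltW.
have L2cut E : measurable E -> periodic_set b E -> L2 (cut E f).
  by move=> mE pE; apply: (Linfl2_L2 hb); exact: Linfl2_cut.
have bM (K : R) : 0 < K -> (0 <= (b * K)%:E)%E by move=> K0; rewrite lee_fin mulr_ge0// ltW.
have upper : {ae mu, forall x, I x -> (p x < +oo)%E -> (p x <= (b * B)%:E * s x)%E}.
  apply: (ae_le_of_integral_le hb) => //.
  - exact: measurable_funeM.
  - by move=> x; rewrite mule_ge0// bM.
  - by move=> x k; rewrite ps.
  move=> E j mE pE _; rewrite -sumE// (scal _ _ (ltW B0) mE pE).
  by rewrite lee_wpmul2l//; exact: (HAB _ (L2cut E mE pE)).2.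
have lower : {ae mu, forall x, I x -> ((b * A)%:E * s x < +oo)%E -> ((b * A)%:E * s x <= p x)%E}.
  apply: (ae_le_of_integral_le hb) => //.
  - exact: measurable_funeM.
  - by move=> x; rewrite mule_ge0// bM.
  - by move=> x k; rewrite ps.
  move=> E j mE pE _; rewrite -sumE// (scal _ _ (ltW A0) mE pE).
  by rewrite lee_wpmul2l//; exact: (HAB _ (L2cut E mE pE)).1.
(* [upper] says something only where [p] is finite; the frame bound for [f] itself shows that this
   is almost everywhere. *)
have poo : {ae mu, forall x, I x -> (p x < +oo)%E}.
  have ipp : mu.-integrable I p.
    apply/integrableP; split; first exact: measurable_funTS.
    under eq_integral do rewrite gee0_abs//.
    have -> : (\int[mu]_(x in I) p x = b%:E * frame_sum f)%E.
      by rewrite frame_sum_integral// muleA -EFinM mulfV ?gt_eqF// mul1e.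
    rewrite lte_mul_pinfty// (le_lt_trans (HAB f Lf2).2)// lte_mul_pinfty//.
    by rewrite lee_fin ltW.
  have H := integrable_ae mI ipp.
  by near=> x => Ix; rewrite -ge0_fin_numE//; exact: (near H x _ Ix).
have soo := sqsum_lty hb Lf2.
have terms := mod_ip_frame_terms Lf Lg'.
have [_ diag] := mod_ip_bracket Lf Lf.
have /Linfl2P[_ [M fM]] := Lf.
exists (fun x => (fine (p x))%:C%C); split.
  (* The sum of the moduli of the terms is [p], which [upper] bounds by [b * B] times the bound [M]
     of [s]. *)
  apply: (wstar_sum_csum (M := b * B * M)).
  - move=> n; apply: cmeasurableM.
      exact: (mod_ip_bracket Lf (Lg' n)).1.
    exact: (mod_ip_bracket (Lg' n) Lf).1.
  - split; last exact: measurable_cst.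
    by apply: measurableT_comp => //; exact: measurable_funTS.
  - near=> x => Ix; have px : (p x < +oo)%E by exact: (near poo x _ Ix).
    have sM : (s x <= M%:E)%E by exact: (near fM x _ Ix).
    have le1 : (p x <= (b * B)%:E * s x)%E by exact: (near upper x _ Ix px).
    rewrite EFinM; apply: le_trans (lee_wpmul2l (bM B B0) sM).
    apply: le_trans le1; rewrite le_eqVlt; apply/orP; left; apply/eqP.
    apply: eq_esum => n _; rewrite (near terms x)// cabsE/= expr0n addr0 sqrtr_sqr.
    by rewrite ger0_norm// sqr_ge0.
  - near=> x => Ix; rewrite [fun n => _](_ : _ = fun n => ((cabs (bracket b f (g_ n) x)) ^+ 2)%:C%C).
      by rewrite csum_real rsum_ge0// => n; exact: sqr_ge0.
    by apply/funext => n; exact: (near terms x).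
near=> x => Ix; have px : (p x < +oo)%E by exact: (near poo x _ Ix).
have sx : (s x < +oo)%E by exact: (near soo x _ Ix).
have pE : (fine (p x))%:E = p x by rewrite fineK// ge0_fin_numE.
have sE : (fine (s x))%:E = s x by rewrite fineK// ge0_fin_numE.
rewrite (near diag x)// bracket_diag -/s -!rmorphM !lecR.
split.
  rewrite -lee_fin EFinM sE pE; apply: (near lower x) => //.
  by rewrite lte_mul_pinfty// bM.
by rewrite -lee_fin EFinM sE pE; apply: (near upper x).
Unshelve. all: by end_near. Qed.

Lemma frame_of_modular_frame : nonstandard_modular_frame b g_ ->
  exists A B : R, [/\ 0 < A, 0 < B & forall f, L2 f ->
    (A%:E * L2normsq f <= frame_sum f)%E /\ (frame_sum f <= B%:E * L2normsq f)%E].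
Proof.
move=> [Lg' [C [D [C0 D0 HCD]]]].
have bounded f : Linfl2 b f ->
    (C%:E * \int[mu]_(x in I) sqsum b f x <= \int[mu]_(x in I) bracket_sum f x)%E /\
    (\int[mu]_(x in I) bracket_sum f x <= D%:E * \int[mu]_(x in I) sqsum b f x)%E.
  move=> Lf; have [S [wS HS]] := HCD f Lf; have Lf2 := Linfl2_L2 hb Lf; have [mf _] := Lf2.
  have terms := mod_ip_frame_terms Lf Lg'; have [_ diag] := mod_ip_bracket Lf Lf.
  have soo := sqsum_lty hb Lf2.
  have mc n : measurable_fun I (fun x => ((cabs (bracket b f (g_ n) x)) ^+ 2)%:E).
    apply: measurable_funTS; apply: measurable_cabs2; apply: cmeasurable_bracket => //.
    by case: (Lg n).
  (* [S] is given only as a weak-* limit, yet its integral is that of [bracket_sum f]; the modular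
     inequality can then be integrated. *)
  have := @wstar_sum_integral R b _ S (fun n x => (cabs (bracket b f (g_ n) x)) ^+ 2) wS.
  rewrite -integral_esum//; last by move=> n x; rewrite lee_fin sqr_ge0.
  have -> : (\int[mu]_(x in I) (\esum_(n in [set: int]) ((cabs (bracket b f (g_ n) x)) ^+ 2)%:E)
    = \int[mu]_(x in I) bracket_sum f x)%E by [].
  move=> -> ; last 3 first.
  - move=> n; apply/integrableP; split; first exact: mc.
    by under eq_integral do rewrite /= ger0_norm ?sqr_ge0//; exact: bracket_sqr_lty.
  - by move=> n x; exact: sqr_ge0.
  - by move=> n; near=> x => Ix; apply: (near terms x).
  have [_ /LinfP[[mRS _] [M SM]] _] := wS.
  (* A version of [S] that is nonnegative everywhere, as the integral lemmas require. It agrees a.e.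
     with the real part, which is at least [C] times a nonnegative number. *)
  pose q x := Num.max 0 (complex.Re (S x)).
  have HS' : {ae mu, forall x, I x ->
      [/\ complex.Re (S x) = q x, (C%:E * sqsum b f x <= (q x)%:E)%E &
          ((q x)%:E <= D%:E * sqsum b f x)%E]}.
    near=> x => Ix; have [] : C%:C%C * mod_ip b f f x <= S x /\ S x <= D%:C%C * mod_ip b f f x.
      exact: (near HS x _ Ix).
    have sx : (sqsum b f x < +oo)%E by exact: (near soo x _ Ix).
    have sE : (fine (sqsum b f x))%:E = sqsum b f x by rewrite fineK// ge0_fin_numE// sqsum_ge0.
    rewrite (near diag x)// bracket_diag -!rmorphM lecE /= => /andP[_ le1].
    rewrite lecE /= => /andP[_ le2].
    have qE : q x = complex.Re (S x).
      by rewrite /q max_r// (le_trans _ le1)// mulr_ge0 ?(ltW C0)// fine_ge0// sqsum_ge0.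
    by rewrite qE -sE -!EFinM !lee_fin; split.
  have mq : measurable_fun I (fun x => (q x)%:E).
    by apply/measurable_EFinP; apply: measurable_maxr.
  have q0 x : (0 <= (q x)%:E)%E by rewrite lee_fin /q le_max lexx.
  have msI : measurable_fun I (sqsum b f) by apply: measurable_funTS; exact: measurable_sqsum.
  have -> : ((\int[mu]_(x in I) complex.Re (S x))%:E = \int[mu]_(x in I) (q x)%:E)%E.
    have qfin : (\int[mu]_(x in I) (q x)%:E)%E \is a fin_num.
      rewrite ge0_fin_numE; last by apply: integral_ge0 => x _.
      apply: (@le_lt_trans _ _ (\int[mu]_(x in I) (D%:E * sqsum b f x))%E).
        apply: ae_ge0_le_integral => //.
        - by move=> x _; rewrite mule_ge0 ?sqsum_ge0// lee_fin ltW.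
        - exact: measurable_funeM.
        by near=> x => Ix; have [] : [/\ complex.Re (S x) = q x, (C%:E * sqsum b f x <= (q x)%:E)%E &
          ((q x)%:E <= D%:E * sqsum b f x)%E] by exact: (near HS' x _ Ix).
      rewrite ge0_integralZl//; last 2 first.
      - by move=> x _; exact: sqsum_ge0.
      - by rewrite lee_fin ltW.
      by rewrite lte_mul_pinfty ?lee_fin ?(ltW D0)// -L2normsq_sqsum//; case: Lf2.
    rewrite -(fineK qfin); congr EFin; congr fine; apply: ae_eq_integral => //.
      exact/measurable_EFinP.
    by near=> x => Ix; have [/= ->] : [/\ complex.Re (S x) = q x, (C%:E * sqsum b f x <= (q x)%:E)%E &
          ((q x)%:E <= D%:E * sqsum b f x)%E] by exact: (near HS' x _ Ix).
  split.
    rewrite -ge0_integralZl//; last 2 first.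
    - by move=> x _; exact: sqsum_ge0.
    - by rewrite lee_fin ltW.
    apply: ae_ge0_le_integral => //.
    - by move=> x _; rewrite mule_ge0 ?sqsum_ge0// lee_fin ltW.
    - exact: measurable_funeM.
    by near=> x => Ix; have [] : [/\ complex.Re (S x) = q x, (C%:E * sqsum b f x <= (q x)%:E)%E &
          ((q x)%:E <= D%:E * sqsum b f x)%E] by exact: (near HS' x _ Ix).
  rewrite -ge0_integralZl//; last 2 first.
  - by move=> x _; exact: sqsum_ge0.
  - by rewrite lee_fin ltW.
  apply: ae_ge0_le_integral => //.
  - by move=> x _; rewrite mule_ge0 ?sqsum_ge0// lee_fin ltW.
  - exact: measurable_funeM.
  by near=> x => Ix; have [] : [/\ complex.Re (S x) = q x, (C%:E * sqsum b f x <= (q x)%:E)%E &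
          ((q x)%:E <= D%:E * sqsum b f x)%E] by exact: (near HS' x _ Ix).
exists (T * C), (T * D); split; [exact: mulr_gt0|exact: mulr_gt0|].
move=> f Lf; have [mf _] := Lf; rewrite frame_sum_integral// (L2normsq_sqsum hb)//.
set s := sqsum b f; set p := bracket_sum f.
have ms : measurable_fun setT s by exact: measurable_sqsum.
have s0 x : (0 <= s x)%E by exact: sqsum_ge0.
have mp : measurable_fun setT p by exact: measurable_bracket_sum.
have p0 x : (0 <= p x)%E by exact: bracket_sum_ge0.
have soo := sqsum_lty hb Lf.
(* Cutting [f] to [E j] gives an element of [Linfl2] with bound [j], to which [bounded] applies. *)
pose E (j : nat) := [set y | (s y < j%:R%:E)%E].
have mE j : measurable (E j) by rewrite -[E j]setTI; exact: emeasurable_fun_infty_o.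
have pE j : periodic_set b (E j) by move=> x n; rewrite /E /= /s sqsum_periodic.
have Lcut j : Linfl2 b (cut (E j) f).
  apply/Linfl2P; split; first exact: cmeasurable_cut.
  exists j%:R; apply: aeW => x _; rewrite sqsum_cut//.
  have [Ex|nE] := pselect (E j x); first by rewrite indicM_in// ltW.
  by rewrite indicM_out// lee_fin.
have bound j : (C%:E * \int[mu]_(x in I) ((\1_(E j) x)%:E * s x) <=
      \int[mu]_(x in I) ((\1_(E j) x)%:E * p x))%E /\
    (\int[mu]_(x in I) ((\1_(E j) x)%:E * p x) <=
      D%:E * \int[mu]_(x in I) ((\1_(E j) x)%:E * s x))%E.
  have := bounded _ (Lcut j).
  have -> : sqsum b (cut (E j) f) = (fun x => ((\1_(E j) x)%:E * s x)%E).
    by apply/funext => x; exact: sqsum_cut.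
  have -> // : bracket_sum (cut (E j) f) = (fun x => ((\1_(E j) x)%:E * p x)%E).
  by apply/funext => x; exact: bracket_sum_cut.
have cut_le (q : R -> \bar R) j : measurable_fun setT q -> (forall x, 0 <= q x)%E ->
    (\int[mu]_(x in I) ((\1_(E j) x)%:E * q x) <= \int[mu]_(x in I) q x)%E.
  move=> mq q0; apply: ge0_le_integral => //.
  - by move=> x _; exact: indicM_ge0.
  - by apply: measurable_funTS; exact: measurable_indicM.
  - exact: measurable_funTS.
  move=> x _; have [Ex|nE] := pselect (E j x); first by rewrite indicM_in.
  by rewrite indicM_out.
rewrite !EFinM -!muleA; split; rewrite lee_wpmul2l ?lee_fin ?(ltW T0)//.
  rewrite -ge0_integralZl//; last 2 first.
  - exact: measurable_funTS.
  - by rewrite lee_fin ltW.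
  apply: (integral_le_of_cuts (s := s)) => //.
  - exact: measurable_funeM.
  - by move=> x; rewrite mule_ge0// lee_fin ltW.
  (* The right-hand side must not depend on [j], so the integral of [p] over [E j] is enlarged to
     all of [I]. *)
  move=> j; apply: le_trans (cut_le p j mp p0); apply: le_trans (bound j).1.
  rewrite -ge0_integralZl//.
  - by under eq_integral do rewrite muleCA.
  - by apply: measurable_funTS; exact: measurable_indicM.
  - by move=> x _; exact: indicM_ge0.
  - by rewrite lee_fin ltW.
apply: (integral_le_of_cuts (s := s)) => // j.
apply: le_trans (bound j).2 _; rewrite lee_wpmul2l ?lee_fin ?(ltW D0)//.
exact: cut_le.
Unshelve. all: by end_near. Qed.

End FrameEquivalence.

Lemma L2_translation (R : realType) (c : R) (g : R -> R[i]) : L2 g -> L2 (translation c g).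
Proof.
move=> [mg goo]; split; first exact: cmeasurable_shift.
rewrite /L2normsq; have := @ge0_integral_shift R c setT (fun x => ((cabs (g x)) ^+ 2)%:E) measurableT.
move=> /(_ (measurable_cabs2 mg) (fun x => sqr_ge0 _)).
by rewrite (_ : [set x | _] = setT)//= => ->.
Qed.

Theorem theorem5p5 (R : realType) (a b : R) (ha : 0 < a) (hb : 0 < b)
    (g : R -> R[i]) (hg : L2 g) :
  gabor_frame a b g <->
  nonstandard_modular_frame b (fun n : int => translation (n%:~R * a) g).
Proof.
have Lg (n : int) : L2 (translation (n%:~R * a) g) by exact: L2_translation.
have sumE f : (\esum_(mn in [set: int * int]) ((cabs (L2ip f (gabor_system a b g mn))) ^+ 2)%:E
    = frame_sum b (fun n : int => translation (n%:~R * a) g) f)%E.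
  by rewrite esum_prod_int// => mn; rewrite lee_fin sqr_ge0.
split.
  move=> [A [B [A0 B0 HAB]]]; apply: (modular_frame_of_frame hb Lg A0 B0) => f Lf.
  by have := HAB f Lf; rewrite /= sumE.
move=> /(frame_of_modular_frame hb Lg)[A [B [A0 B0 HAB]]].
exists A, B; split => // f Lf /=.
by rewrite sumE; exact: HAB.
Qed.
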